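(* Suppose that $G$ is consistent and positive definite. Let $\omega\in\mathcal M^+$ be such that $G\omega$ is quasicontinuous, and let $A\subset X$ be quasiclosed. Write $f:=1_AG\omega$. (a) If $c^*(f)<+\infty$ then $f\in\mathcal H_0^*$. (b) If $X$ has a countable base of open sets then $f$ is $c$-capacitable: $c^*(f)=c_*(f)$.
   Context: $X$ is a nonempty locally compact Hausdorff space, $\mathcal M^+$ the set of positive Radon measures on $X$ with the vague topology (coarsest topology making $\mu\mapsto\int\varphi\,d\mu$ continuous for every continuous compactly supported $\varphi$). $G:X\times X\to[0,+\infty]$ is a kernel: lower semicontinuous (l.s.c.), symmetric, and $G(x,x)>0$ for all $x$. For $\mu\in\mathcal M^+$: $G\mu(x)=\int G(x,y)\,d\mu(y)$, $\|\mu\|=(\int G\mu\,d\mu)^{1/2}$; $\mathcal E^+=\{\mu\in\mathcal M^+:\|\mu\|<+\infty\}$, $\mathcal E^+_1=\{\mu\in\mathcal M^+:\|\mu\|\le1\}$. $1_AG\omega$ equals $G\omega$ on $A$ and $0$ off $A$. $\mathcal F^+$: all functions $X\to[0,+\infty]$. $\mathcal G$: l.s.c. functions in $\mathcal F^+$. $\mathcal H_0$: finite-valued upper semicontinuous (u.s.c.) functions $X\to[0,+\infty[$ of compact support. $\mathcal C_0^+=\mathcal G\cap\mathcal H_0$. Energy capacity: $c(\varphi)=\max\{\int\varphi\,d\mu:\mu\in\mathcal E_1^+\}$ for $\varphi\in\mathcal C_0^+$; $c(h)=\inf\{c(\varphi):\varphi\in\mathcal C_0^+,\varphi\ge h\}$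 for $h\in\mathcal H_0$; $c(g)=\sup\{c(\varphi):\varphi\in\mathcal C_0^+,\varphi\le g\}$ for $g\in\mathcal G$. For $f\in\mathcal F^+$: $c_*(f)=\sup\{c(h):h\in\mathcal H_0,h\le f\}$, $c^*(f)=\inf\{c(g):g\in\mathcal G,g\ge f\}$; $c^*(E)=c^*(1_E)$ for $E\subset X$. $\mathcal H_0^*$: the set of $f\in\mathcal F^+$ with $\inf\{c^*(f-h):h\in\mathcal H_0,h\le f\}=0$. $f\in\mathcal F^+$ is quasicontinuous (resp. quasi u.s.c.) if for every $\varepsilon>0$ there is $V\subset X$ with $c^*(V)<\varepsilon$ such that $f|_{X\setminus V}$ is continuous as a map into $[0,+\infty]$ (resp. u.s.c.). A set $A\subset X$ is quasiclosed if $1_A$ is quasi u.s.c. $G$ is consistent if for every $\lambda\in\mathcal E^+$ the function $\mu\mapsto\int G\lambda\,d\mu$ on $\mathcal E^+_1$ is finite and vaguely continuous. $G$ is positive definite if $\int G\mu\,d\nu\le\|\mu\|\,\|\nu\|$ for all $\mu,\nu\in\mathcal E^+$. *)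

(* Defs.v *)
From HB Require Import structures.
From mathcomp Require Import all_boot all_order all_algebra.
From mathcomp Require Import all_classical all_reals all_analysis.

Set Implicit Arguments.
Unset Strict Implicit.
Unset Printing Implicit Defensive.

Import Order.TTheory GRing.Theory Num.Theory.
Import numFieldNormedType.Exports.

Local Open Scope classical_set_scope.
Local Open Scope ring_scope.

(* The measurable-structure interface of the library requires a pointed type,
   so "nonempty topological space" is rendered by ptopologicalType. *)
Definition borel (X : ptopologicalType) := g_sigma_algebraType (@open X).

Definition compact_support (X : topologicalType) (V : nmodType) (f : X -> V) :=
  compact (closure [set x | f x != 0]).

(* Positive Radon measures on a locally compact Hausdorff space: the Borel
   measures that represent the positive linear forms on the continuous compactly
   supported functions, normalized (as in the Riesz representation theorem) to be
   outer regular on Borel sets and inner regular on open sets. Other normalizations change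
   the measure only on some Borel sets of infinite measure, and leave the integral
   of every nonnegative lower semicontinuous function unchanged. *)
Section radon.
Local Open Scope ereal_scope.
Variables (R : realType) (X : ptopologicalType).

Definition is_radon (mu : {measure set (borel X) -> \bar R}) :=
  [/\ forall K : set X, compact K -> mu K < +oo,
      forall B : set (borel X), measurable B ->
        mu B = ereal_inf [set mu U | U in [set U : set X | open U /\ B `<=` U]]
    & forall U : set X, open U ->
        mu U = ereal_sup [set mu K | K in [set K : set X | compact K /\ K `<=` U]]].

Record radon := Radon {
  radon_measure :> {measure set (borel X) -> \bar R};
  radonP : is_radon radon_measure }.

HB.instance Definition _ := gen_eqMixin radon.
HB.instance Definition _ := gen_choiceMixin radon.

Record test_fun := TestFun {
  test_val :> X -> R;
  test_continuous : continuous test_val;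
  test_support : compact_support test_val }.

Definition vague_eval (mu : radon) : prod_topology (fun _ : test_fun => R) :=
  fun phi => (\int[mu]_x phi x)%R.

(* The initial topology of mu |-> (\int phi dmu)_phi into the product R^test_fun
   is the coarsest one making every mu |-> \int phi dmu continuous. *)
HB.instance Definition _ := Topological.copy radon (initial_topology vague_eval).

End radon.

Section energy.
Local Open Scope ereal_scope.
Variables (R : realType) (X : ptopologicalType).
Implicit Types (G : X -> X -> \bar R) (mu nu lambda : radon R X).

Definition potential_kernel G :=
  [/\ forall x y, 0 <= G x y,
      lower_semicontinuous (fun p : X * X => G p.1 p.2),
      forall x y, G x y = G y x
    & forall x, 0 < G x x].

Definition potential G mu : X -> \bar R := fun x => \int[mu]_y G x y.

Definition enorm G mu : \bar R := sqrte (\int[mu]_x potential G mu x).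

Definition finite_energy G : set (radon R X) := [set mu | enorm G mu < +oo].

Definition energy_le1 G : set (radon R X) := [set mu | enorm G mu <= 1].

Definition consistent G := forall lambda, finite_energy G lambda ->
  (forall mu, energy_le1 G mu -> \int[mu]_x potential G lambda x < +oo) /\
  {within energy_le1 G,
    continuous (fun mu : radon R X => \int[mu]_x potential G lambda x)}.

Definition positive_definite G := forall mu nu,
  finite_energy G mu -> finite_energy G nu ->
  \int[nu]_x potential G mu x <= enorm G mu * enorm G nu.

End energy.

Section capacity.
Local Open Scope ereal_scope.
Variables (R : realType) (X : ptopologicalType).
Implicit Types (G : X -> X -> \bar R) (f g h phi : X -> \bar R) (A E V : set X).

Definition upper_semicontinuous (Y : topologicalType) (f : Y -> \bar R) :=
  lower_semicontinuous (fun x => - f x).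

Definition Fplus : set (X -> \bar R) := [set f | forall x, 0 <= f x].

Definition lscplus : set (X -> \bar R) :=
  [set g | Fplus g /\ lower_semicontinuous g].

Definition H0 : set (X -> \bar R) :=
  [set h | [/\ forall x, 0 <= h x < +oo, upper_semicontinuous h
             & compact_support h]].

Definition C0plus : set (X -> \bar R) := lscplus `&` H0.

(* The supremum is attained (energy_le1 G is vaguely compact); as a definition it
   is written ereal_sup rather than max. *)
Definition cap_C G phi : \bar R :=
  ereal_sup [set \int[mu]_x phi x | mu in energy_le1 G].

Definition cap_H G h : \bar R :=
  ereal_inf [set cap_C G phi |
    phi in [set phi | C0plus phi /\ forall x, h x <= phi x]].

Definition cap_G G g : \bar R :=
  ereal_sup [set cap_C G phi |
    phi in [set phi | C0plus phi /\ forall x, phi x <= g x]].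

Definition cap_lower G f : \bar R :=
  ereal_sup [set cap_H G h | h in [set h | H0 h /\ forall x, h x <= f x]].

Definition cap_upper G f : \bar R :=
  ereal_inf [set cap_G G g | g in [set g | lscplus g /\ forall x, f x <= g x]].

Definition indic_ereal E : X -> \bar R := fun x => (\1_E x)%:E.

Definition cap_upper_set G E : \bar R := cap_upper G (indic_ereal E).

Definition H0star G : set (X -> \bar R) :=
  [set f | Fplus f /\
    ereal_inf [set cap_upper G (fun x => f x - h x) |
      h in [set h | H0 h /\ forall x, h x <= f x]] = 0].

Definition quasicontinuous G f := forall e : R, (0 < e)%R ->
  exists2 V : set X, cap_upper_set G V < e%:E & {within ~` V, continuous f}.

(* In subspace (~` V) every point of V is isolated, so no condition is imposed
   there: this is upper semicontinuity of the restriction of f to ~` V. *)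
Definition quasi_usc G f := forall e : R, (0 < e)%R ->
  exists2 V : set X, cap_upper_set G V < e%:E
    & upper_semicontinuous (f : subspace (~` V) -> \bar R).

Definition quasiclosed G A := quasi_usc G (indic_ereal A).

End capacity.

(* Main.v *)
Require Import Defs.
From HB Require Import structures.
From mathcomp Require Import all_boot all_order all_algebra.
From mathcomp Require Import all_classical all_reals all_analysis.
From mathcomp Require Import measurable_realfun ring lra.
Set Implicit Arguments.
Unset Strict Implicit.
Unset Printing Implicit Defensive.
Import Order.TTheory GRing.Theory Num.Theory.
Import numFieldNormedType.Exports.

(** The function f = 1_A G omega is quasi-u.s.c. (quasi_usc_indic): off a set
    of small capacity, the potential is continuous at the points of A, and near
    the other points the indicator of A vanishes.  Both assertions hold for
    every quasi-u.s.c. f >= 0, and both rest on one principle (dominate,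
    dominate_ae).

    Let E_1 be the set of measures of energy at most 1, and suppose that every
    h in H0 with h <= f satisfies \int h dmu <= C on E_1.  Then a single u in
    E_1 satisfies h <= C G u almost everywhere for every measure of E_1, and
    this for all such h at once.  For one h, such a u is obtained by minimizing
    half the energy minus the integral of h/C over E_1 (obstacle); that u does
    not depend on h follows from the compactness of E_1 and from consistency,
    because the measures u which fail for a given h and a given test measure
    form an open subset of E_1.

    The vague compactness of E_1 (energy_le1_compact) has three ingredients:
    positivity of G on the diagonal bounds the mass near each point, the Riesz
    representation theorem produces a limit measure from limits of integrals,
    and the energy is l.s.c. for the vague topology.  Consistency and a Dini
    argument on E_1 show that C G u exceeds some continuous phi <= C G u of
    compact support only by a function of small capacity (potential_dini).

    For (a), take an l.s.c. g >= f of finite capacity and apply the principle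
    to g.  The excess of g over phi has small capacity, since every member of
    H0 below g is at most C G u outside a negligible set (lsc_excess).  The
    minimum of f and phi is u.s.c. once a small open set is removed, hence it
    becomes a member of H0 that approximates f (quasi_usc_H0star).

    For (b), let C be slightly larger than the inner capacity of f, and apply
    the principle to f itself.  The truncations of f at height n over an
    exhausting sequence of compact sets belong to H0star by (a), so each is at
    most C G u plus an l.s.c. function of capacity as small as desired; the sum
    of these functions and C G u is an l.s.c. majorant of f.  Positive
    definiteness bounds the capacity of C G u by C, and C is arbitrarily close
    to the inner capacity (quasi_usc_capacitable). *)

Local Open Scope classical_set_scope.
Local Open Scope ring_scope.

(** * Compactness, test functions and bumps *)

(** The extraction of finite subcovers in the form of an induction.  If P failed
    on K, the sets A with P (K \ A) would form a proper filter without cluster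
    point in K. *)
Lemma compact_induction (T : topologicalType) (P : set T -> Prop) (K : set T) :
  compact K -> P set0 -> (forall A B, P A -> P B -> P (A `|` B)) ->
  (forall A B, A `<=` B -> P B -> P A) ->
  (forall x, K x -> exists2 V, nbhs x V & P V) -> P K.
Proof.
move=> cK P0 PU PS loc; apply: contrapT => nPK.
pose F : set_system T := [set A | P (K `\` A)].
have FF : ProperFilter F.
  apply: Build_ProperFilter_ex.
    move=> A FA; apply: contrapT => /nonemptyPn A0; apply: nPK.
    by move: FA; rewrite /F /= A0 setD0.
  split; rewrite /F /=.
  - by rewrite setDT.
  - move=> A B PA PB; apply: (PS _ _ _ (PU _ _ PA PB)) => y [Ky nAB].
    have [Ay|nAy] := pselect (A y); last by left.
    by right; split => // By; exact: nAB.
  - by move=> A B AB; apply: PS; exact: setDS.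
have [|x [Kx clx]] := cK F FF; first by rewrite /F /= setDv.
have [V Vx PV] := loc x Kx.
have /clx/(_ Vx) : F (~` V).
  by rewrite /F /=; apply: PS PV => y [_ /contrapT].
by move=> [y [nVy Vy]].
Qed.

Section Cc.
Context {R : realType} {X : topologicalType}.
Implicit Types f g : X -> R.

(** The members of C0plus as real-valued functions (see Ccplus_C0plus), on which
    linear forms can be evaluated and subtraction is available. *)
Definition Ccplus f := [/\ continuous f, compact_support f & forall x, 0 <= f x].

Lemma compact_supportS (V W : nmodType) (f : X -> V) (g : X -> W) :
  (forall x, g x != 0 -> f x != 0) -> compact_support f -> compact_support g.
Proof.
move=> fg cf; apply: (subclosed_compact _ cf); first exact: closed_closure.
by apply: closureS => x /= ; exact: fg.
Qed.

Lemma compact_supportU (V W U : nmodType) (f : X -> V) (g : X -> W) (h : X -> U) :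
  (forall x, h x != 0 -> f x != 0 \/ g x != 0) ->
  compact_support f -> compact_support g -> compact_support h.
Proof.
move=> fg cf cg; have := compactU cf cg; rewrite -closureU => cfg.
apply: (subclosed_compact _ cfg); first exact: closed_closure.
by apply: closureS => x /= ; exact: fg.
Qed.

Lemma Ccplus0 : Ccplus (fun=> 0).
Proof.
split => //; first by move=> x; exact: cvg_cst.
rewrite /compact_support (_ : [set _ | _] = set0) ?closure0 ?compact0//.
  exact: compact0.
by apply/seteqP; split => x //=; rewrite eqxx.
Qed.

Lemma CcplusD f g : Ccplus f -> Ccplus g -> Ccplus (fun x => f x + g x).
Proof.
move=> [cf sf f0] [cg sg g0]; split; last by move=> x; rewrite addr_ge0.
  by move=> x; apply: cvgD; [exact: cf|exact: cg].
apply: compact_supportU sf sg => x; case: (eqVneq (f x) 0) => [->|]; last by left.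
by rewrite add0r; right.
Qed.

Lemma CcplusZ f c : 0 <= c -> Ccplus f -> Ccplus (fun x => c * f x).
Proof.
move=> c0 [cf sf f0]; split; last by move=> x; rewrite mulr_ge0.
  by move=> x; apply: cvgM; [exact: cvg_cst|exact: cf].
by apply: compact_supportS sf => x; apply: contra_neq => ->; rewrite mulr0.
Qed.

Lemma Ccplus_max f g : Ccplus f -> Ccplus g -> Ccplus (fun x => Num.max (f x) (g x)).
Proof.
move=> [cf sf f0] [cg sg g0]; split; last by move=> x; rewrite le_max f0.
  exact: max_fun_continuous.
apply: compact_supportU sf sg => x; case: (eqVneq (f x) 0) => [->|]; last by left.
case: (eqVneq (g x) 0) => [->|]; last by right.
by rewrite maxxx eqxx.
Qed.

Lemma Ccplus_min f g : Ccplus f -> continuous g -> (forall x, 0 <= g x) ->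
  Ccplus (fun x => Num.min (f x) (g x)).
Proof.
move=> [cf sf f0] cg g0; split; last by move=> x; rewrite le_min f0 g0.
  exact: min_fun_continuous.
by apply: compact_supportS sf => x; apply: contra_neq => ->; apply/min_idPl.
Qed.

Lemma Ccplus_sub f g : Ccplus f -> continuous g -> (forall x, 0 <= g x) ->
  Ccplus (fun x => Num.max (f x - g x) 0).
Proof.
move=> [cf sf f0] cg g0; split; last by move=> x; rewrite le_max lexx orbT.
  apply: (@max_fun_continuous _ _ R (fun x => f x - g x) (fun=> 0)) => x; last exact: cvg_cst.
  by apply: cvgB; [exact: cf|exact: cg].
apply: compact_supportS sf => x; apply: contra_neq => ->.
by apply/max_idPr; rewrite sub0r oppr_le0.
Qed.

Lemma Ccplus_trunc f (e : R) : 0 < e -> Ccplus f -> Ccplus (fun x => Num.max (f x - e) 0).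
Proof.
move=> e0 cf; apply: (@Ccplus_sub f (fun=> e)) => //; first by move=> x; exact: cvg_cst.
by move=> x; exact: ltW.
Qed.

Lemma CcplusB f g : Ccplus f -> Ccplus g -> (forall x, g x <= f x) ->
  Ccplus (fun x => f x - g x).
Proof.
move=> [cf sf f0] [cg sg g0] fg; split; last by move=> x; rewrite subr_ge0.
  by move=> x; apply: cvgB; [exact: cf|exact: cg].
apply: compact_supportU sf sg => x; case: (eqVneq (f x) 0) => [->|]; last by left.
by rewrite sub0r oppr_eq0; right.
Qed.

Lemma Ccplus_bounded f : Ccplus f -> exists2 M, 0 < M & forall x, f x <= M.
Proof.
move=> [cf sf f0].
pose P (A : set X) := exists2 M, 0 < M & forall x, A x -> f x <= M.
have [||||M M0 fM] := compact_induction (P := P) sf.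
- by exists 1.
- move=> A B [M M0 fM] [N N0 fN]; exists (M + N); first exact: addr_gt0.
  by move=> x [/fM|/fN] h; rewrite (le_trans h)// ?lerDl ?lerDr ltW.
- by move=> A B AB [M M0 fM]; exists M => // x /AB/fM.
- move=> x _; exists [set y | f y < f x + 1].
    by apply: (cvgr_lt (f x) (cf x)); rewrite ltrDl.
  by exists (f x + 1); [rewrite ltr_wpDl|move=> y /ltW].
exists M => // x; have [->|fx] := eqVneq (f x) 0; first exact: ltW.
by apply: fM; exact: subset_closure.
Qed.

Lemma Ccplus_level_closed f (e : R) : Ccplus f -> closed [set x | e <= f x].
Proof.
move=> [cf _ _]; apply: (@closed_comp _ _ f [set y | e <= y]); last exact: closed_ge.
by move=> x _; exact: cf.
Qed.

Lemma Ccplus_level_open f (e : R) : Ccplus f -> open [set x | e < f x].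
Proof.
move=> [cf _ _]; apply: (@open_comp _ _ f [set y | e < y]); last exact: open_gt.
by move=> x _; exact: cf.
Qed.

Lemma Ccplus_level_compact f (e : R) : 0 < e -> Ccplus f -> compact [set x | e <= f x].
Proof.
move=> e0 cf; have [_ sf _] := cf; apply: (subclosed_compact _ sf).
  exact: Ccplus_level_closed.
move=> x /= h; apply: subset_closure => /=; rewrite gt_eqF//.
exact: lt_le_trans h.
Qed.

Hypotheses (hX : hausdorff_space X) (lcX : locally_compact [set: X]).

Lemma lc_compact_nbhs (x : X) : exists2 K, nbhs x K & compact K /\ closed K.
Proof.
have [V Vx [cV clV]] := @lcX x I; exists V => //.
have {}Vx : nbhs x [set y | [set: X] y -> V y] by exact: Vx.
by apply: filterS Vx => y /(_ I).
Qed.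

(** A locally compact Hausdorff space is completely regular; separating x from
    the complement of a neighbourhood with compact closure keeps the support of
    the separating function compact. *)
Lemma urysohn_point (x : X) (U : set X) : nbhs x U ->
  exists f, [/\ Ccplus f, forall y, f y <= 1, forall y, ~ U y -> f y = 0 &
    nbhs x [set y | 1 / 2 < f y]].
Proof.
move=> Ux; have [K Kx [cK clK]] := lc_compact_nbhs x.
have UK : nbhs x (U `&` K) by apply: filterI.
pose W := (U `&` K)^°.
have : @completely_regular_space X by exact: (@locally_compact_completely_regular X R).
move=> /(_ x (~` W)) [].
- by apply: open_closedC; exact: open_interior.
- by apply; exact: nbhs_singleton (nbhs_interior UK).
move=> uT EP; have /(@uniform_separatorP _ R)[g [cg g01 g0 g1]] : uniform_separator [set x] (~` W).
  by exists uT.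
have gx : g x = 0 by apply: g0; exists x.
have gW y : ~ W y -> g y = 1 by move=> h; apply: g1; exists y.
have gle y : 0 <= g y <= 1.
  by have /g01 : range g (g y) by exists y.
exists (fun y => 1 - g y); split.
- split; last by move=> y; rewrite subr_ge0; have /andP[] := gle y.
    by move=> y; apply: cvgB; [exact: cvg_cst|exact: cg].
  apply: (subclosed_compact _ cK); first exact: closed_closure.
  rewrite [K in _ `<=` K](closure_id K).1//; apply: closureS => y /= h.
  have [/interior_subset[]//|nW] := pselect (W y).
  by move: h; rewrite gW// subrr eqxx.
- by move=> y; rewrite gerBl; have /andP[] := gle y.
- move=> y nU; rewrite gW ?subrr// => /interior_subset[]//.
- have : nbhs x [set y | g y < 1 / 2] by apply: (cvgr_lt (g x) (cg x)); rewrite gx divr_gt0.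
  by apply: filterS => y /= h; lra.
Qed.

(** Finitely many bumps cover K; their sum is truncated at 1. *)
Lemma urysohn_compact (K U : set X) : compact K -> open U -> K `<=` U ->
  exists f, [/\ Ccplus f, forall y, f y <= 1, forall y, ~ U y -> f y = 0 &
    forall y, K y -> f y = 1].
Proof.
move=> cK oU KU.
pose P (A : set X) := exists f, [/\ Ccplus f, forall y, ~ U y -> f y = 0 &
    forall y, A y -> 1 <= f y].
have [||||f [cf fU fK]] := compact_induction (P := P) cK.
- by exists (fun=> 0); split => //; exact: Ccplus0.
- move=> A B [f [cf fU fA]] [g [cg gU gB]]; exists (fun x => f x + g x); split.
  + exact: CcplusD.
  + by move=> y nU; rewrite fU// gU// addr0.
  + move=> y [/fA|/gB] h; rewrite (le_trans h)//.
      by rewrite lerDl; case: cg.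
    by rewrite lerDr; case: cf.
- by move=> A B AB [f [cf fU fB]]; exists f; split => // y /AB /fB.
- move=> x Kx; have [|f [cf _ fU fx]] := @urysohn_point x U.
    by apply: open_nbhs_nbhs; split => //; exact: KU.
  exists [set y | 1 / 2 < f y] => //; exists (fun y => 2 * f y); split.
  + exact: CcplusZ.
  + by move=> y nU; rewrite fU// mulr0.
  + by move=> y /= h; lra.
exists (fun y => Num.min (f y) 1); split.
- by apply: Ccplus_min => // x; exact: cvg_cst.
- by move=> y; rewrite ge_min lexx orbT.
- by move=> y nU; rewrite fU//; apply/min_idPl.
- by move=> y Ky; apply/min_idPr; exact: fK.
Qed.

End Cc.

(** * Lower semicontinuous functions *)

Section lsc.
Local Open Scope ereal_scope.
Context {R : realType} {X : topologicalType}.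
Implicit Types f g : X -> \bar R.

Lemma lsc_continuous (f : X -> R) : continuous f ->
  lower_semicontinuous (fun x => (f x)%:E).
Proof.
move=> cf; apply/lower_semicontinuousP => a.
apply: (@open_comp _ _ f [set y | (a < y)%R]); last exact: open_gt.
by move=> x _; exact: cf.
Qed.

Lemma lscD f g : (forall x, -oo < f x) -> (forall x, -oo < g x) ->
  lower_semicontinuous f -> lower_semicontinuous g ->
  lower_semicontinuous (fun x => f x + g x).
Proof.
move=> fN gN lf lg x a afg.
have [b [c [bf cg abc]]] : exists b c, [/\ b%:E < f x, c%:E < g x & (a <= b + c)%R].
  move: afg (fN x) (gN x); case: (f x) => [r| |]//; case: (g x) => [s| |]//=.
  - rewrite -EFinD lte_fin => ars _ _.
    exists (r - (r + s - a) / 2)%R, (s - (r + s - a) / 2)%R; rewrite !lte_fin.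
    by split; lra.
  - move=> _ _ _; exists (r - 1)%R, (a - r + 1)%R; split; rewrite ?ltry// ?lte_fin; lra.
  - move=> _ _ _; exists (a - s + 1)%R, (s - 1)%R; split; rewrite ?ltry// ?lte_fin; lra.
  - by move=> _ _ _; exists a, 0%R; split; rewrite ?ltry// addr0.
have [V Vx Vf] := lf x b bf; have [W Wx Wg] := lg x c cg.
exists (V `&` W); first exact: filterI.
move=> y [/Vf fy /Wg gy]; apply: le_lt_trans (lteD fy gy).
by rewrite -EFinD lee_fin.
Qed.

Lemma lsc_max f g : lower_semicontinuous f -> lower_semicontinuous g ->
  lower_semicontinuous (fun x => maxe (f x) (g x)).
Proof.
move=> lf lg x a; rewrite lt_max => /orP[/lf[V Vx h]|/lg[V Vx h]];
  by exists V => // y Vy; rewrite lt_max h ?orbT.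
Qed.

Lemma lsc_min f g : lower_semicontinuous f -> lower_semicontinuous g ->
  lower_semicontinuous (fun x => mine (f x) (g x)).
Proof.
move=> lf lg x a; rewrite lt_min => /andP[/lf[V Vx Vf] /lg[W Wx Wg]].
exists (V `&` W); first exact: filterI.
by move=> y [/Vf fy /Wg gy]; rewrite lt_min fy.
Qed.

Lemma lsc_cst (c : \bar R) : lower_semicontinuous (fun _ : X => c).
Proof. by move=> x a ac; exists setT => //; exact: filterT. Qed.

Lemma lscZ (c : R) f : (0 <= c)%R -> (forall x, 0 <= f x) ->
  lower_semicontinuous f -> lower_semicontinuous (fun x => c%:E * f x).
Proof.
rewrite le_eqVlt => /predU1P[<-|c0] f0 lf.
  under eq_fun do rewrite mul0e; exact: lsc_cst.
move=> x a; rewrite muleC -lte_pdivrMr// -EFinM => h.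
have [V Vx Vf] := lf _ _ h; exists V => // y /Vf.
by rewrite muleC EFinM lte_pdivrMr.
Qed.

Lemma lsc_indic (U : set X) : open U -> lower_semicontinuous (fun x => (\1_U x)%:E : \bar R).
Proof.
move=> oU x a; rewrite indicE; case: (boolP (x \in U)) => xU /=.
  move=> a1; exists U; first by apply: open_nbhs_nbhs; split => //; exact: set_mem.
  by move=> y Uy; rewrite indicE mem_set.
move=> a0; exists setT; first exact: filterT.
by move=> y _; apply: (lt_le_trans a0); rewrite lee_fin.
Qed.

Lemma lsc_sup (f : nat -> X -> \bar R) : (forall n, lower_semicontinuous (f n)) ->
  lower_semicontinuous (fun x => ereal_sup (range (f ^~ x))).
Proof.
move=> lf x a /ereal_sup_gt[_ [n _ <-]] /lf[V Vx Vf].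
by exists V => // y /Vf h; apply: (lt_le_trans h); apply: ereal_sup_ubound; exists n.
Qed.

Lemma lsc_nneseries (f : nat -> X -> \bar R) : (forall n x, 0 <= f n x) ->
  (forall n, lower_semicontinuous (f n)) ->
  lower_semicontinuous (fun x => \sum_(n <oo) f n x).
Proof.
move=> f0 lf.
have lS n : lower_semicontinuous (fun x => \sum_(0 <= k < n) f k x).
  elim: n => [|n ih]; first by under eq_fun do rewrite big_geq//; exact: lsc_cst.
  under eq_fun do rewrite big_nat_recr//=.
  by apply: lscD => // x; rewrite (lt_le_trans ltNy0)// sume_ge0.
have -> : (fun x => \sum_(n <oo) f n x) =
    (fun x => ereal_sup (range (fun n => \sum_(0 <= k < n) f k x))).
  apply/funext => x; apply/cvg_lim => //; apply: ereal_nondecreasing_cvgn.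
  exact: ereal_nondecreasing_series.
exact: (lsc_sup lS).
Qed.

End lsc.

Section ereal_aux.
Local Open Scope ereal_scope.
Context {R : realType}.
Implicit Types (x y : \bar R) (u : (\bar R)^nat).

Lemma lee_real_ltP x y : (forall a : R, a%:E < x -> a%:E <= y) -> x <= y.
Proof.
move=> h; rewrite leNgt; apply/negP => yx.
have [a [ya ax]] : exists a : R, y < a%:E /\ a%:E < x.
  move: yx; case: y {h} => [r| |]; case: x => [s| |]//=.
  - by rewrite lte_fin => rs; exists ((r + s) / 2)%R; rewrite !lte_fin midf_lt// midf_lt.
  - by move=> _; exists (r + 1)%R; rewrite ltry lte_fin ltrDl.
  - by move=> _; exists (s - 1)%R; rewrite ltNyr lte_fin gtrDl ltrN10.
  - by move=> _; exists 0%R; rewrite ltNyr ltry.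
by have := lt_le_trans ya (h _ ax); rewrite ltxx.
Qed.

Lemma limn_einf_ge u (a : \bar R) N : (forall n, (N <= n)%N -> a <= u n) -> a <= limn_einf u.
Proof.
move=> h; rewrite limn_einf_lim; apply: lime_ge; first exact: is_cvg_einfs.
exists N => // n /= Nn; apply: le_ereal_inf_tmp => _ [k /= nk <-].
by apply: h; exact: leq_trans nk.
Qed.

Lemma limn_einf_le u (c : \bar R) : (forall n, u n <= c) -> limn_einf u <= c.
Proof.
move=> h; rewrite limn_einf_lim; apply: lime_le; first exact: is_cvg_einfs.
exists 0%N => // n _; apply: le_trans (h n); apply: ereal_inf_lbound.
by exists n => //=.
Qed.

End ereal_aux.

(** * Integrals of l.s.c. functions as suprema over test functions *)

Section integrals.
Local Open Scope ereal_scope.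
Context {R : realType} {X : ptopologicalType}.
Implicit Types (f : X -> R) (g : X -> \bar R) (m : {measure set (borel X) -> \bar R}).

Lemma borel_open (U : set X) : open U -> measurable (U : set (borel X)).
Proof. by move=> oU; apply: sub_sigma_algebra. Qed.

Lemma borel_closed (U : set X) : closed U -> measurable (U : set (borel X)).
Proof.
by move=> cU; rewrite -[U]setCK; apply: measurableC; apply: borel_open; exact: closed_openC.
Qed.

Lemma lsc_measurable (g : X -> \bar R) : lower_semicontinuous g ->
  measurable_fun [set: borel X] (g : borel X -> \bar R).
Proof.
move=> lg; apply: (measurability _ (ErealGenOInfty.measurableE R)).
move=> /= _ [_ [a ->]] <-; apply: measurableI => //.
rewrite preimage_itvoy; apply: borel_open.
by move/lower_semicontinuousP : lg; exact.
Qed.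

Lemma usc_measurable (h : X -> \bar R) : upper_semicontinuous h ->
  measurable_fun [set: borel X] (h : borel X -> \bar R).
Proof.
move=> /lsc_measurable mh; rewrite (_ : h = (fun x => - - h x)).
  exact: measurableT_comp mh.
by apply/funext => x; rewrite oppeK.
Qed.

Lemma Ccplus_measurable f : Ccplus f ->
  measurable_fun [set: borel X] ((fun x => (f x)%:E) : borel X -> \bar R).
Proof. by move=> [cf _ _]; apply: lsc_measurable; exact: lsc_continuous. Qed.

(** Only the values on the cone of nonnegative test functions are constrained:
    they determine the representing measure. *)
Definition pos_linear (Lam : (X -> R) -> R) :=
  [/\ forall f, Ccplus f -> (0 <= Lam f)%R,
      forall f (g : X -> R), Ccplus f -> Ccplus g -> Lam (fun x => f x + g x)%R = (Lam f + Lam g)%R &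
      forall (c : R) f, (0 <= c)%R -> Ccplus f -> Lam (fun x => c * f x)%R = (c * Lam f)%R].

(** The Daniell extension of Lam to l.s.c. functions; for the form defined by a
    Radon measure it is the integral (radon_inner_sup). *)
Definition inner_sup (Lam : (X -> R) -> R) (g : X -> \bar R) : \bar R :=
  ereal_sup [set (Lam f)%:E | f in [set f | Ccplus f /\ forall x, (f x)%:E <= g x]].

Lemma inner_sup_ub Lam g f : Ccplus f -> (forall x, (f x)%:E <= g x) -> (Lam f)%:E <= inner_sup Lam g.
Proof. by move=> cf fg; apply: ereal_sup_ubound; exists f. Qed.

Lemma le_inner_sup Lam (g h : X -> \bar R) : (forall x, g x <= h x) -> inner_sup Lam g <= inner_sup Lam h.
Proof.
move=> gh; apply: le_ereal_sup => _ [f [cf fg] <-]; exists f => //; split => // x.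
exact: le_trans (fg x) (gh x).
Qed.

Section pos_linear.
Variables (Lam : (X -> R) -> R) (pL : pos_linear Lam).

Lemma pos_linear0 : Lam (fun=> 0%R) = 0%R.
Proof.
by have [_ _ /(_ 0%R _ (lexx _) Ccplus0)] := pL; rewrite !mul0r.
Qed.

Lemma pos_linear_le f (g : X -> R) : Ccplus f -> Ccplus g -> (forall x, (f x <= g x)%R) -> (Lam f <= Lam g)%R.
Proof.
move=> cf cg fg; have [L0 LD _] := pL.
have cgf : Ccplus (fun x => g x - f x)%R by exact: CcplusB.
rewrite (_ : g = (fun x => f x + (g x - f x)))%R; first by rewrite LD// lerDl L0.
by apply/funext => x; rewrite addrC subrK.
Qed.

Lemma inner_sup_ge0 g : (forall x, 0 <= g x) -> 0 <= inner_sup Lam g.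
Proof. by move=> g0; have := inner_sup_ub Lam Ccplus0 g0; rewrite pos_linear0. Qed.

(** Test functions below g and below h add up to one below g + h; the finiteness
    arguments serve to subtract inside suprema. *)
Lemma inner_supD (g h : X -> \bar R) : (forall x, 0 <= g x) -> (forall x, 0 <= h x) ->
  inner_sup Lam g + inner_sup Lam h <= inner_sup Lam (fun x => g x + h x).
Proof.
move=> g0 h0; have [L0 LD _] := pL.
set S := inner_sup Lam (fun x => g x + h x).
have [Sy|Sfin] := eqVneq S +oo; first by rewrite Sy leey.
have S0 : 0 <= S by apply: inner_sup_ge0 => x; exact: adde_ge0.
have Sf : S \is a fin_num by rewrite ge0_fin_numE// ltey.
have H f : Ccplus f -> (forall x, (f x)%:E <= g x) -> inner_sup Lam h <= S - (Lam f)%:E.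
  move=> cf fg; apply: ge_ereal_sup => _ [k [ck kh] <-].
  rewrite leeBrDr// -EFinD -LD//; apply: inner_sup_ub; first exact: CcplusD.
  by move=> x; rewrite EFinD addeC leeD.
have hS : inner_sup Lam h \is a fin_num.
  rewrite ge0_fin_numE ?inner_sup_ge0//; apply: le_lt_trans (H _ Ccplus0 g0) _.
  by rewrite pos_linear0 sube0 ltey.
rewrite -leeBrDr//; apply: ge_ereal_sup => _ [f [cf fg] <-].
by rewrite leeBrDr// addeC -leeBrDr//; exact: H.
Qed.

Lemma inner_supZ (t : R) (g : X -> \bar R) : (0 < t)%R -> (forall x, 0 <= g x) ->
  t%:E * inner_sup Lam g <= inner_sup Lam (fun x => t%:E * g x).
Proof.
move=> t0 g0; have [_ _ LZ] := pL.
rewrite muleC -lee_pdivlMr//; apply: ge_ereal_sup => _ [f [cf fg] <-].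
rewrite lee_pdivlMr// -EFinM mulrC -LZ//; last exact: ltW.
apply: inner_sup_ub => [|x].
  by apply: CcplusZ => //; exact: ltW.
by rewrite EFinM lee_pmul2l.
Qed.

Variable m : {measure set (borel X) -> \bar R}.
Hypothesis m_open : forall U : set X, open U -> m U <= inner_sup Lam (fun x => (\1_U x)%:E).

Variables (g : X -> \bar R) (g0 : forall x, 0 <= g x) (lg : lower_semicontinuous g).

(** L t N x is the largest natural multiple of t strictly below g x (or 0 if
    g x = 0), capped at N t; it is a sum of indicators of open sets. *)
Let U (t : R) k : set X := [set x | (k.+1%:R * t)%:E < g x].
Let L (t : R) N (x : X) : \bar R := \sum_(k < N) t%:E * (\1_(U t k) x)%:E.

Let oU (t : R) k : open (U t k).
Proof. by move/lower_semicontinuousP : lg; exact. Qed.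

Let layer_ge0 (t : R) N x : (0 < t)%R -> 0 <= L t N x.
Proof. by move=> t0; apply: sume_ge0 => k _; rewrite -EFinM lee_fin mulr_ge0// ltW. Qed.

Let layer_bounds (t : R) N x : (0 < t)%R ->
  [/\ L t N x <= g x, L t N x <= (N%:R * t)%:E &
      L t N x = (N%:R * t)%:E \/ g x <= L t N x + t%:E].
Proof.
move=> t0; elim: N => [|N [Lg LN LgN]].
  by rewrite /L big_ord0 mul0r; split => //; left.
rewrite /L big_ord_recr/= -/(L t N x) indicE.
have NE : (N.+1%:R * t = N%:R * t + t)%R by rewrite -natr1 mulrDl mul1r.
case: (boolP (x \in U t N)) => [/set_mem /= Ux|/negP xU].
- rewrite mule1; have LNE : L t N x = (N%:R * t)%:E.
    case: LgN => // gL; have : g x <= (N.+1%:R * t)%:E.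
      by rewrite (le_trans gL)// NE EFinD leeD2r.
    by move=> /(lt_le_trans Ux); rewrite ltxx.
  rewrite LNE -EFinD -NE; split => //; [exact: ltW|by left].
- rewrite mule0 adde0; split => //.
    by rewrite (le_trans LN)// lee_fin NE lerDl ltW.
  right; case: LgN => [->|//]; rewrite -EFinD -NE leNgt; apply/negP => h.
  by apply: xU; exact: mem_set.
Qed.

Let int_layer (t : R) N : (0 < t)%R -> \int[m]_x L t N x <= inner_sup Lam (L t N).
Proof.
move=> t0; elim: N => [|N ih].
  rewrite /L; under eq_integral do rewrite big_ord0.
  by rewrite integral0 inner_sup_ge0// => x; rewrite big_ord0.
have mU k : measurable_fun [set: borel X] ((fun x => (\1_(U t k) x)%:E) : borel X -> \bar R).
  by apply: lsc_measurable; exact: lsc_indic.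
have LE : L t N.+1 = (fun x => L t N x + t%:E * (\1_(U t N) x)%:E).
  by apply/funext => x; rewrite /L big_ord_recr.
rewrite LE ge0_integralD//; last 4 first.
- by move=> x _; exact: layer_ge0.
- apply: emeasurable_sum => k; apply: measurable_funeM; exact: mU.
- by move=> x _; rewrite -EFinM lee_fin mulr_ge0// ltW.
- by apply: measurable_funeM; exact: mU.
apply: le_trans (inner_supD _ _); last 2 first.
- by move=> x; exact: layer_ge0.
- by move=> x; rewrite -EFinM lee_fin mulr_ge0// ltW.
apply: leeD => //; rewrite ge0_integralZl//; last by rewrite lee_fin ltW.
rewrite integral_indic//; last by apply: borel_open.
rewrite setIT; apply: le_trans (inner_supZ t0 _) => //.
by apply: lee_pmul => //; [rewrite lee_fin ltW|exact: m_open].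
Qed.

(** Superadditivity of the inner supremum carries the hypothesis on open sets
    over to the layered functions L t N, and Fatou's lemma carries it over to
    their limit g.  Both the continuity of Radon measures along directed families
    of functions and the Riesz representation rest on this bound. *)
Lemma integral_le_inner_sup : \int[m]_x g x <= inner_sup Lam g.
Proof.
(* (n+1)^2 steps of size 1/(n+1): the mesh tends to 0 and the cap n+1 to infinity *)
pose t n : R := (n.+1%:R^-1)%R; pose N n := (n.+1 * n.+1)%N.
have t0 n : (0 < t n)%R by rewrite invr_gt0.
have Lmeas n : measurable_fun [set: borel X] (L (t n) (N n) : borel X -> \bar R).
  apply: emeasurable_sum => k; apply: measurable_funeM.
  by apply: lsc_measurable; exact: lsc_indic.
have tE n : ((N n)%:R * t n = n.+1%:R)%R by rewrite /N natrM -mulrA mulfV ?mulr1.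
have limL x : g x <= limn_einf (fun n => L (t n) (N n) x).
  apply: lee_real_ltP => a ag.
  have [M [Ma Mg]] : exists M : nat, (a < M.+1%:R)%R /\ (a + M.+1%:R^-1)%:E < g x.
    have [d d0 dg] : exists2 d : R, (0 < d)%R & (a + d)%:E < g x.
      case: (g x) ag => [r| |//]; last by exists 1%R; rewrite ?ltry.
      rewrite lte_fin => ar; exists ((r - a) / 2)%R; rewrite ?lte_fin; lra.
    exists (Num.truncn (Num.max a d^-1)%R).
    have := truncnS_gt (Num.max a d^-1)%R; rewrite gt_max => /andP[aM dM]; split => //.
    apply: le_lt_trans dg; rewrite lee_fin lerD2l -[leRHS]invrK.
    by rewrite lef_pV2 ?posrE ?invr_gt0// ltW.
  apply: (@limn_einf_ge _ _ _ M) => n Mn.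
  have [_ _ []] := layer_bounds (N n) x (t0 n).
    move=> ->; rewrite tE lee_fin (le_trans (ltW Ma))// ler_nat ltnS//.
  move=> gL; rewrite -(@leeD2rE _ (t n)%:E)//; apply: le_trans gL; apply: le_trans (ltW Mg).
  by rewrite -EFinD lee_fin lerD2l /t lef_pV2 ?posrE// ler_nat ltnS.
apply: (@le_trans _ _ (\int[m]_x limn_einf (fun n => L (t n) (N n) x))).
  apply: ge0_le_integral => //.
  - exact: lsc_measurable.
  - rewrite /limn_einf; apply: measurableT_comp => //.
    apply: measurable_fun_limn_esup => n.
    exact: measurableT_comp (Lmeas n).
apply: (le_trans (fatou m measurableT Lmeas _)).
  by move=> n x _; exact: layer_ge0.
apply: limn_einf_le => n; apply: (le_trans (int_layer _ (t0 n))).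
by apply: le_inner_sup => x; have [] := layer_bounds (N n) x (t0 n).
Qed.

End pos_linear.
End integrals.

(** * Radon measures as positive linear forms *)

Section locally_finite.
Local Open Scope ereal_scope.
Context {R : realType} {X : ptopologicalType}.
Hypotheses (hX : hausdorff_space X) (lcX : locally_compact [set: X]).
Implicit Types (f : X -> R) (g : X -> \bar R) (m : {measure set (borel X) -> \bar R}).

(** Replacing f by (f - e)^+ costs at most e Lam c, where c equals 1 on the
    support of f.  The truncated function vanishes off the compact set
    {f >= e}, which lies inside the set where f is positive. *)
Lemma pos_linear_trunc (Lam : (X -> R) -> R) f (d : R) : pos_linear Lam -> Ccplus f ->
  (0 < d)%R -> exists2 e : R, (0 < e)%R &
    (Lam f <= Lam (fun x => Num.max (f x - e) 0) + d)%R.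
Proof.
move=> pL cf d0; have [L0 LD LZ] := pL.
have [c [cc _ _ cK]] : exists c : X -> R, [/\ Ccplus c, forall y, (c y <= 1)%R,
    forall y, ~ setT y -> c y = 0%R & forall y, closure [set x | f x != 0%R] y -> c y = 1%R].
  by apply: urysohn_compact => //; [case: cf|exact: openT].
exists (d / (Lam c + 1))%R; first by rewrite divr_gt0// ltr_wpDl// L0.
set e := (d / _)%R.
have e0 : (0 < e)%R by rewrite divr_gt0// ltr_wpDl// L0.
have cfe : Ccplus (fun x => Num.max (f x - e) 0)%R by exact: Ccplus_trunc.
have cec : Ccplus (fun x => e * c x)%R by apply: CcplusZ => //; exact: ltW.
apply: (@le_trans _ _ (Lam (fun x => Num.max (f x - e) 0 + e * c x)))%R.
  apply: pos_linear_le => //; first exact: CcplusD.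
  move=> x; have [fx|fx] := eqVneq (f x) 0%R.
    rewrite fx addr_ge0//; first by rewrite le_max lexx orbT.
    by apply: mulr_ge0; [exact: ltW|case: cc].
  rewrite cK ?mulr1; last exact: subset_closure.
  by rewrite -lerBlDr le_max lexx.
rewrite LD// lerD2l LZ//; last exact: ltW.
rewrite /e mulrAC ler_pdivrMr ?ltr_wpDl ?L0//.
by rewrite ler_pM2l// lerDl.
Qed.

Definition compact_finite m := forall K : set X, compact K -> m K < +oo.

Lemma compact_finite_Ccplus_lty m f : compact_finite m -> Ccplus f -> \int[m]_x (f x)%:E < +oo.
Proof.
move=> fm cf; have [M M0 fM] := Ccplus_bounded cf.
pose K := closure [set x | f x != 0%R].
have cK : compact K by case: cf.
have mK : measurable (K : set (borel X)) by apply: borel_closed; exact: closed_closure.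
apply: (@le_lt_trans _ _ (\int[m]_x (M%:E * (\1_K x)%:E))).
  apply: ge0_le_integral => //.
  - by move=> x _; rewrite lee_fin; case: cf.
  - exact: Ccplus_measurable.
  - by apply: measurable_funeM; apply/measurable_EFinP; exact: measurable_indic.
  - move=> x _; rewrite -EFinM lee_fin; have [->|fx] := eqVneq (f x) 0%R.
      by apply: mulr_ge0 => //; exact: ltW.
    by rewrite indicE mem_set ?mulr1//; exact: subset_closure.
rewrite ge0_integralZl//; last 2 first.
- by apply/measurable_EFinP; exact: measurable_indic.
- by rewrite lee_fin ltW.
rewrite integral_indic// setIT; apply: lte_mul_pinfty => //.
- by rewrite lee_fin ltW.
- exact: fm.
Qed.

Lemma Ccplus_integral_ge0 m f : Ccplus f -> 0 <= \int[m]_x (f x)%:E.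
Proof. by move=> [_ _ f0]; apply: integral_ge0 => x _; rewrite lee_fin. Qed.

Definition test_integral m f : R := fine (\int[m]_x (f x)%:E).

Lemma test_integralE m f : compact_finite m -> Ccplus f -> (test_integral m f)%:E = \int[m]_x (f x)%:E.
Proof.
move=> fm cf; rewrite /test_integral fineK// ge0_fin_numE ?Ccplus_integral_ge0//.
exact: compact_finite_Ccplus_lty.
Qed.

Lemma test_integral_pos_linear m : compact_finite m -> pos_linear (test_integral m).
Proof.
move=> fm; split.
- by move=> f cf; rewrite -lee_fin test_integralE// Ccplus_integral_ge0.
- move=> f g cf cg; apply: EFin_inj; rewrite EFinD !test_integralE//; last exact: CcplusD.
  under eq_integral do rewrite EFinD.
  rewrite ge0_integralD//; [|exact: Ccplus_measurable| |exact: Ccplus_measurable].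
  + by move=> x _; rewrite lee_fin; case: cf.
  + by move=> x _; rewrite lee_fin; case: cg.
- move=> c f c0 cf; apply: EFin_inj; rewrite EFinM !test_integralE//; last exact: CcplusZ.
  under eq_integral do rewrite EFinM.
  rewrite ge0_integralZl//; first exact: Ccplus_measurable.
  by move=> x _; rewrite lee_fin; case: cf.
Qed.

Lemma inner_sup_le_integral m g : compact_finite m -> (forall x, 0 <= g x) ->
  lower_semicontinuous g -> inner_sup (test_integral m) g <= \int[m]_x g x.
Proof.
move=> fm g0 lg; apply: ge_ereal_sup => _ [f [cf fg] <-].
rewrite test_integralE//; apply: ge0_le_integral => //.
- by move=> x _; rewrite lee_fin; case: cf.
- exact: Ccplus_measurable.
- exact: lsc_measurable.
Qed.

Lemma radon_compact_finite (mu : radon R X) : compact_finite mu.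
Proof. by have [] := radonP mu. Qed.

(** Inner regularity and a bump between K and U. *)
Lemma radon_open_le (mu : radon R X) (U : set X) : open U ->
  mu U <= inner_sup (test_integral mu) (fun x => (\1_U x)%:E).
Proof.
move=> oU; have [fK _ ->//] := radonP mu.
apply: ge_ereal_sup => _ [K [cK KU] <-].
have [f [cf f1 fU fK1]] := @urysohn_compact R X hX lcX K U cK oU KU.
have clK : closed K by exact: compact_closed.
apply: (@le_trans _ _ (test_integral mu f)%:E); last first.
  apply: inner_sup_ub => // x; rewrite lee_fin indicE.
  by case: (boolP (x \in U)) => [_|/negP xU] //=; rewrite fU// => Ux; apply: xU; exact: mem_set.
rewrite test_integralE//.
have mK : measurable (K : set (borel X)) by exact: borel_closed.
have -> : mu K = \int[mu]_x (\1_K x)%:E by rewrite integral_indic// setIT.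
apply: ge0_le_integral => //.
- by apply/measurable_EFinP; exact: measurable_indic.
- exact: Ccplus_measurable.
- move=> x _; rewrite lee_fin indicE.
  case: (boolP (x \in K)) => [/set_mem xK|_] /=; first by rewrite fK1.
  by case: cf.
Qed.

(** The integral of an l.s.c. function is a supremum over a directed family of
    test functions, although the family is uncountable: inner regularity on
    open sets propagates through the layer-cake bound. *)
Lemma radon_inner_sup (mu : radon R X) g : (forall x, 0 <= g x) ->
  lower_semicontinuous g -> \int[mu]_x g x = inner_sup (test_integral mu) g.
Proof.
move=> g0 lg; apply/eqP; rewrite eq_le; apply/andP; split.
  apply: integral_le_inner_sup => //; first exact/test_integral_pos_linear/radon_compact_finite.
  exact: radon_open_le.
by apply: inner_sup_le_integral => //; exact: radon_compact_finite.
Qed.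

(** The truncation by e leaves a margin: it turns pointwise inequalities with f
    at one point into inequalities with (f - e)^+ on a neighbourhood. *)
Lemma radon_lsc_approx (mu : radon R X) g (a : R) : (forall x, 0 <= g x) ->
  lower_semicontinuous g -> a%:E < \int[mu]_x g x ->
  exists (f : X -> R) (e : R), [/\ Ccplus f, (0 < e)%R, forall x, (f x)%:E <= g x &
    (a%:E < \int[mu]_x (Num.max (f x - e) 0)%:E)].
Proof.
move=> g0 lg; rewrite radon_inner_sup// => /ereal_sup_gt[_ [f [cf fg] <-]].
rewrite lte_fin => af.
have [|e e0 Le] := @pos_linear_trunc (test_integral mu) f ((test_integral mu f - a) / 2)%R
  (test_integral_pos_linear (@radon_compact_finite mu)) cf; first by rewrite divr_gt0// subr_gt0.
exists f, e; split => //.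
have cfe : Ccplus (fun x => Num.max (f x - e) 0)%R by exact: Ccplus_trunc.
rewrite -test_integralE//; last exact: radon_compact_finite.
by rewrite lte_fin; lra.
Qed.

End locally_finite.

(** * The Riesz representation theorem *)

Section riesz.
Local Open Scope ereal_scope.
Context {R : realType} {X : ptopologicalType}.
Hypotheses (hX : hausdorff_space X) (lcX : locally_compact [set: X]).
Variables (Lam : (X -> R) -> R) (pL : pos_linear Lam).

Definition riesz_open (V : set X) : \bar R := inner_sup Lam (fun x => (\1_V x)%:E).

Definition riesz_outer (E : set X) : \bar R :=
  ereal_inf [set riesz_open V | V in [set V | open V /\ E `<=` V]].

Let le_indic (A B : set X) x : A `<=` B -> (\1_A x : R)%:E <= (\1_B x)%:E.
Proof.
move=> AB; rewrite lee_fin !indicE ler_nat.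
by case: (boolP (x \in A)) => // /set_mem/AB/mem_set ->.
Qed.

Let indic_le (f : X -> R) (V : set X) : (forall x, (f x <= 1)%R) ->
  (forall x, ~ V x -> (f x <= 0)%R) -> forall x, (f x)%:E <= (\1_V x)%:E.
Proof.
move=> f1 fV x; rewrite lee_fin indicE; case: (boolP (x \in V)) => [_|/negP xV] //=.
by apply: fV => Vx; apply: xV; exact: mem_set.
Qed.

Let indic_off (f : X -> R) (V : set X) x : (f x)%:E <= (\1_V x)%:E -> ~ V x -> (f x <= 0)%R.
Proof. by move=> + xV; rewrite lee_fin indicE memNset. Qed.

Let indic1 (f : X -> R) (V : set X) x : (f x)%:E <= (\1_V x)%:E -> (f x <= 1)%R.
Proof. by rewrite lee_fin indicE => /le_trans; apply; rewrite lern1 leq_b1. Qed.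

Lemma le_riesz_open : {homo riesz_open : A B / A `<=` B >-> A <= B}.
Proof. by move=> A B AB; apply: le_inner_sup => x; exact: le_indic. Qed.

Lemma riesz_open_ge0 V : 0 <= riesz_open V.
Proof. by apply: inner_sup_ge0 => // x; rewrite lee_fin. Qed.

Lemma riesz_outer_ge0 E : 0 <= riesz_outer E.
Proof. by apply: le_ereal_inf_tmp => _ [V _ <-]; exact: riesz_open_ge0. Qed.

Lemma riesz_outer_open V : open V -> riesz_outer V = riesz_open V.
Proof.
move=> oV; apply/eqP; rewrite eq_le; apply/andP; split.
  by apply: ereal_inf_lbound; exists V => //; split.
by apply: le_ereal_inf_tmp => _ [W [oW VW] <-]; exact: le_riesz_open.
Qed.

Lemma le_riesz_outer : {homo riesz_outer : A B / A `<=` B >-> A <= B}.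
Proof.
move=> A B AB; apply: le_ereal_inf => _ [V [oV BV] <-]; exists V => //; split => //.
exact: subset_trans BV.
Qed.

Lemma riesz_outer0 : riesz_outer set0 = 0.
Proof.
rewrite riesz_outer_open; last exact: open0.
apply/eqP; rewrite eq_le riesz_open_ge0 andbT; apply: ge_ereal_sup => _ [f [cf f0] <-].
rewrite lee_fin -(pos_linear0 pL); apply: pos_linear_le => //; first exact: Ccplus0.
by move=> x; apply: indic_off (f0 x) _.
Qed.

Lemma riesz_outer_adherent E (d : R) : (0 < d)%R ->
  exists V, [/\ open V, E `<=` V & riesz_open V <= riesz_outer E + d%:E].
Proof.
move=> d0; have [Ey|] := eqVneq (riesz_outer E) +oo.
  by exists setT; split => //; [exact: openT|rewrite Ey addye ?leey].
move=> Ey; have Ef : riesz_outer E \is a fin_num.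
  by rewrite ge0_fin_numE ?riesz_outer_ge0// ltey.
have [_ [V [oV EV] <-] h] := lb_ereal_inf_adherent d0 Ef.
by exists V; split => //; exact: ltW.
Qed.

Let cut (f : X -> R) (e : R) : X -> R := fun x => Num.max (f x - e)%R 0%R.

Let Ccplus_cut f e : (0 < e)%R -> Ccplus f -> Ccplus (cut f e).
Proof. exact: Ccplus_trunc. Qed.

Let cut_le f e x : (0 < e)%R -> Ccplus f -> (cut f e x <= f x)%R.
Proof. by move=> e0 [_ _ f0]; rewrite /cut ge_max f0 gerBl ltW. Qed.

Let cut_off f e x : ~ (e <= f x)%R -> cut f e x = 0%R.
Proof. by move=> /negP; rewrite -ltNge => h; apply/max_idPr; rewrite subr_le0 ltW. Qed.

(** The truncation of a test function f below the indicator of the union is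
    split as its minimum with s1, which lives on U, and the rest, which lives on
    V because s1 + s2 >= 1 >= f on the compact set carrying the truncation.  This
    replaces a partition of unity. *)
Lemma riesz_openU U V : open U -> open V ->
  riesz_open (U `|` V) <= riesz_open U + riesz_open V.
Proof.
move=> oU oV; apply: ge_ereal_sup => _ [f [cf fUV] <-].
apply/lee_addgt0Pr => d d0.
have [e e0 fe] := pos_linear_trunc hX lcX pL cf d0.
rewrite -/(cut f e) in fe.
pose K := [set x | e <= f x]%R.
have cK : compact K by exact: Ccplus_level_compact.
have KUV : K `<=` U `|` V.
  move=> x /= Kx; apply: contrapT => /(indic_off (fUV x)).
  by rewrite leNgt (lt_le_trans e0 Kx).
pose P (A : set X) := exists s1 s2 : X -> R, [/\ Ccplus s1, Ccplus s2,
  forall x, ~ U x -> s1 x = 0%R, forall x, ~ V x -> s2 x = 0%R &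
  forall x, A x -> (1 <= s1 x + s2 x)%R].
have [||||s1 [s2 [cs1 cs2 s1U s2V sK]]] := compact_induction (P := P) cK.
- by exists (fun=> 0%R), (fun=> 0%R); split => //; exact: Ccplus0.
- move=> A B [s1 [s2 [c1 c2 s1U s2V sA]]] [t1 [t2 [d1 d2 t1U t2V tB]]].
  exists (fun x => s1 x + t1 x)%R, (fun x => s2 x + t2 x)%R; split.
  + exact: CcplusD.
  + exact: CcplusD.
  + by move=> x Ux; rewrite s1U// t1U// addr0.
  + by move=> x Vx; rewrite s2V// t2V// addr0.
  + have := c1 => -[_ _ /(_ _)p1]; have := c2 => -[_ _ /(_ _)p2].
    have := d1 => -[_ _ /(_ _)q1]; have := d2 => -[_ _ /(_ _)q2].
    move=> x; have := p1 x; have := p2 x; have := q1 x; have := q2 x.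
    by move=> ? ? ? ? [/sA|/tB]; lra.
- move=> A B AB [s1 [s2 [c1 c2 s1U s2V sA]]]; exists s1, s2; split => //.
  by move=> x /AB/sA.
- move=> x Kx.
  have H W : open W -> W x -> exists s : X -> R, [/\ Ccplus s, forall x, ~ W x -> s x = 0%R &
      nbhs x [set y | 1 <= s y]%R].
    move=> oW Wx; have [|s [cs _ sW sx]] := @urysohn_point R X hX lcX x W.
      by apply: open_nbhs_nbhs.
    exists (fun y => 2 * s y)%R; split; first exact: CcplusZ.
      by move=> y Wy; rewrite sW// mulr0.
    by apply: filterS sx => y /= h; lra.
  have [Ux|Vx] := KUV _ Kx.
    have [s [cs sU sx]] := H _ oU Ux; exists [set y | 1 <= s y]%R => //.
    exists s, (fun=> 0%R); split => //; first exact: Ccplus0.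
    by move=> y /=; rewrite addr0.
  have [s [cs sV sx]] := H _ oV Vx; exists [set y | 1 <= s y]%R => //.
  exists (fun=> 0%R), s; split => //; first exact: Ccplus0.
  by move=> y /=; rewrite add0r.
have cfe := Ccplus_cut e0 cf.
pose f1 x := Num.min (cut f e x) (s1 x).
have cf1 : Ccplus f1 by case: cs1 => ? ? ?; exact: Ccplus_min.
have f1le x : (f1 x <= cut f e x)%R by rewrite ge_min lexx.
have cf2 : Ccplus (fun x => cut f e x - f1 x)%R by exact: CcplusB.
have cut1 x : (cut f e x <= 1)%R by rewrite (le_trans (cut_le _ _ _))// (indic1 (fUV x)).
have [_ LD _] := pL.
have LE : Lam (cut f e) = (Lam f1 + Lam (fun x => cut f e x - f1 x))%R.
  rewrite -LD//; congr (Lam _); apply/funext => x; by rewrite addrC subrK.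
apply: (@le_trans _ _ ((Lam f1)%:E + (Lam (fun x => cut f e x - f1 x)%R)%:E + d%:E)).
  by rewrite -!EFinD lee_fin -LE.
rewrite leeD2r//; apply: leeD; apply: inner_sup_ub => //; apply: indic_le => x.
- exact: le_trans (cut1 x).
- by move=> Ux; rewrite /f1 s1U// ge_min lexx orbT.
- rewrite lerBlDr (le_trans (cut1 x))// lerDl; by case: cf1.
- move=> Vx; rewrite subr_le0 /f1 le_min lexx /=.
  have [Kx|Kx] := pselect (K x); last by rewrite cut_off//; case: cs1.
  by have := sK x Kx; rewrite s2V// addr0; exact: le_trans.
Qed.

(** The truncation of a test function below the indicator of the union is
    carried by a compact set, which finitely many of the open sets cover. *)
Lemma riesz_open_bigcup (V : nat -> set X) : (forall n, open (V n)) ->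
  riesz_open (\bigcup_n V n) <= \sum_(n <oo) riesz_open (V n).
Proof.
move=> oV.
have fin n : riesz_open (\big[setU/set0]_(k < n) V k) <= \sum_(k < n) riesz_open (V k).
  elim: n => [|n ih]; first by rewrite !big_ord0 -riesz_outer_open ?riesz_outer0//; exact: open0.
  rewrite !big_ord_recr /=; apply: (le_trans (riesz_openU _ _)) => //.
    by apply: big_ind => //; [exact: open0|exact: openU].
  exact: leeD.
apply: ge_ereal_sup => _ [f [cf fV] <-]; apply/lee_addgt0Pr => d d0.
have [e e0 fe] := pos_linear_trunc hX lcX pL cf d0.
rewrite -/(cut f e) in fe.
pose K := [set x | e <= f x]%R.
have cK : compact K by exact: Ccplus_level_compact.
have [||||n Kn] := compact_induction
   (P := fun A => exists n, A `<=` \big[setU/set0]_(k < n) V k) cK.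
- by exists 0%N.
- move=> A B [n An] [k Bk]; exists (maxn n k); rewrite subUset; split.
    apply: (subset_trans An); exact: (@subset_bigsetU _ V _ _ (leq_maxl _ _)).
  apply: (subset_trans Bk); exact: (@subset_bigsetU _ V _ _ (leq_maxr _ _)).
- by move=> A B AB [n Bn]; exists n; exact: subset_trans Bn.
- move=> x /= Kx; have [n _ Vx] : (\bigcup_n V n) x.
    apply: contrapT => /(indic_off (fV x)).
    by rewrite leNgt (lt_le_trans e0 Kx).
  exists (V n); first exact: open_nbhs_nbhs.
  by exists n.+1; rewrite big_ord_recr /=; exact: subsetUr.
apply: (@le_trans _ _ ((Lam (cut f e))%:E + d%:E)); first by rewrite -EFinD lee_fin.
rewrite leeD2r//; apply: (@le_trans _ _ (riesz_open (\big[setU/set0]_(k < n) V k))).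
  apply: inner_sup_ub; first exact: Ccplus_cut.
  apply: indic_le => x; first by rewrite (le_trans (cut_le _ _ _))// (indic1 (fV x)).
  by move=> nx; rewrite cut_off// => /Kn.
apply: (le_trans (fin n)); rewrite -(big_mkord xpredT (fun k => riesz_open (V k))).
by apply: nneseries_lim_ge => k _ _; exact: riesz_open_ge0.
Qed.

Lemma riesz_outer_sigma_subadditive : sigma_subadditive riesz_outer.
Proof.
move=> F; apply/lee_addgt0Pr => d d0.
have dn n : (0 < d / (2 ^ n.+1)%:R)%R by rewrite divr_gt0// ltr0n expn_gt0.
pose V n := projT1 (cid (riesz_outer_adherent (F n) (dn n))).
have VP n : [/\ open (V n), F n `<=` V n & riesz_open (V n) <= riesz_outer (F n) + (d / (2 ^ n.+1)%:R)%:E].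
  exact: projT2 (cid (riesz_outer_adherent (F n) (dn n))).
apply: (@le_trans _ _ (riesz_open (\bigcup_n V n))).
  apply: ereal_inf_lbound; exists (\bigcup_n V n) => //; split.
    by apply: bigcup_open => n _; have [] := VP n.
  by move=> x [n _ Fx]; exists n => //; have [_ + _] := VP n; exact.
apply: le_trans (riesz_open_bigcup _) _; first by move=> n; have [] := VP n.
apply: le_trans (epsilon_trick _ _ (ltW d0)) => //; last by move=> n; exact: riesz_outer_ge0.
by apply: lee_nneseries => n _; [move=> _; exact: riesz_open_ge0|have [] := VP n].
Qed.

(** The Caratheodory condition for an open V.  Replace E by an open W containing
    E; if f nearly exhausts W and V, and its truncation is carried by the compact
    set K, then W \ K is open, contains W \ V, and test functions below its
    indicator can be added to the truncation of f without exceeding 1 on W. *)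
Lemma riesz_outer_split V E : open V ->
  riesz_outer (E `&` V) + riesz_outer (E `&` ~` V) <= riesz_outer E.
Proof.
move=> oV; apply: le_ereal_inf_tmp => _ [W [oW EW] <-].
apply: (@le_trans _ _ (riesz_outer (W `&` V) + riesz_outer (W `&` ~` V))).
  by apply: leeD; apply: le_riesz_outer; exact: setSI.
have [Wy|Wy] := eqVneq (riesz_open W) +oo; first by rewrite Wy leey.
have Wf : riesz_open W \is a fin_num by rewrite ge0_fin_numE ?riesz_open_ge0// ltey.
have WVf : riesz_outer (W `&` ~` V) \is a fin_num.
  rewrite ge0_fin_numE ?riesz_outer_ge0//; apply: le_lt_trans (_ : riesz_open W < +oo); last by rewrite ltey.
  by rewrite -riesz_outer_open//; apply: le_riesz_outer; exact: subIsetl.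
rewrite riesz_outer_open; last exact: openI.
rewrite -leeBrDr//; apply: ge_ereal_sup => _ [f [cf fV] <-]; rewrite leeBrDr//.
apply/lee_addgt0Pr => d d0.
have [e e0 fe] := pos_linear_trunc hX lcX pL cf d0.
rewrite -/(cut f e) in fe.
pose K := [set x | e <= f x]%R.
have oWK : open (W `\` K).
  by rewrite setDE; apply: openI => //; apply: closed_openC; exact: Ccplus_level_closed.
have KV : K `<=` W `&` V.
  by move=> x /= Kx; apply: contrapT => /(indic_off (fV x)); rewrite leNgt (lt_le_trans e0 Kx).
apply: (@le_trans _ _ (inner_sup Lam (fun x => (cut f e x)%:E) + d%:E + riesz_open (W `\` K))).
  apply: leeD; last first.
    rewrite -riesz_outer_open//; apply: le_riesz_outer => x [Wx nVx]; split => // /KV[].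
    by move=> _; exact: nVx.
  apply: (@le_trans _ _ ((Lam (cut f e))%:E + d%:E)); first by rewrite -EFinD lee_fin.
  by rewrite leeD2r//; apply: inner_sup_ub => //; exact: Ccplus_cut.
rewrite addeAC leeD2r//; apply: le_trans (inner_supD pL _ _) _.
- by move=> x; rewrite lee_fin /cut le_max lexx orbT.
- by move=> x; rewrite lee_fin.
apply: le_inner_sup => x; rewrite -EFinD lee_fin.
have [Kx|Kx] := pselect (K x).
  rewrite [X in (_ + X)%R]indicE memNset; last by case.
  rewrite addr0 indicE mem_set; last by have [] := KV x Kx.
  by rewrite (le_trans (cut_le _ _ _))// (indic1 (fV x)).
rewrite cut_off// add0r -lee_fin; apply: le_indic; exact: subDsetl.
Qed.

Let outer_mu : {outer_measure set X -> \bar R} := HB.pack riesz_outer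
  (isOuterMeasure.Build R X riesz_outer riesz_outer0 riesz_outer_ge0
    le_riesz_outer riesz_outer_sigma_subadditive).

Let borel_caratheodory (B : set (borel X)) : measurable B ->
  outer_mu.-cara.-measurable B.
Proof.
move=> mB; suff : <<s @open X >> `<=` (outer_mu.-cara.-measurable : set (set X)) by exact.
apply: smallest_sub; first exact: sigma_algebra_measurable.
move=> V oV; apply: le_caratheodory_measurable => E /=; exact: riesz_outer_split.
Qed.

Let riesz_sigma_additive : semi_sigma_additive (riesz_outer : set (borel X) -> \bar R).
Proof.
move=> F mF tF mUF; apply: (@caratheodory_measure_sigma_additive R X outer_mu F) => //.
  by move=> n; exact: borel_caratheodory.
exact: borel_caratheodory.
Qed.

Definition riesz_measure : {measure set (borel X) -> \bar R} := HB.pack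
  (riesz_outer : set (borel X) -> \bar R)
  (isMeasure.Build _ (borel X) R (riesz_outer : set (borel X) -> \bar R)
    riesz_outer0 riesz_outer_ge0 riesz_sigma_additive).

Let muE B : riesz_measure B = riesz_outer B. Proof. by []. Qed.

Let outer_compact_lty (K : set X) : compact K -> riesz_outer K < +oo.
Proof.
move=> cK; have [f [cf _ _ fK]] := @urysohn_compact R X hX lcX K setT cK openT (@subsetT _ _).
have oV : open [set x | 1 / 2 < f x]%R by exact: Ccplus_level_open.
apply: (@le_lt_trans _ _ (riesz_open [set x | 1 / 2 < f x]%R)).
  rewrite -riesz_outer_open//; apply: le_riesz_outer => x /fK /= ->; lra.
apply: (@le_lt_trans _ _ (Lam (fun x => 2 * f x)%R)%:E); last by rewrite ltry.
apply: ge_ereal_sup => _ [g [cg gV] <-]; rewrite lee_fin.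
have cf2 : Ccplus (fun x => 2 * f x)%R by exact: CcplusZ.
apply: pos_linear_le => // x; have [fx|fx] := pselect (1 / 2 < f x)%R.
  by have := indic1 (gV x); lra.
have := indic_off (gV x) fx; case: cf => _ _ /(_ x); lra.
Qed.

(** Outer regularity is built into the outer measure.  For inner regularity on
    an open U, the truncation of f <= 1_U lies below the indicator of every open
    set containing the compact set {f >= e}, so Lam of it is at most the outer
    measure of that compact set. *)
Lemma riesz_radon : is_radon riesz_measure.
Proof.
split.
- by move=> K cK; rewrite muE; exact: outer_compact_lty.
- move=> B mB; rewrite muE; congr ereal_inf; apply/seteqP; split.
    by move=> _ [V [oV BV] <-]; exists V => //; rewrite -riesz_outer_open.
  by move=> _ [V [oV BV] <-]; exists V => //; rewrite -riesz_outer_open.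
- move=> U oU; rewrite muE; apply/eqP; rewrite eq_le; apply/andP; split; last first.
    by apply: ge_ereal_sup => _ [K [cK KU] <-]; apply: le_riesz_outer.
  rewrite riesz_outer_open//; apply: ge_ereal_sup => _ [f [cf fU] <-].
  apply/lee_addgt0Pr => d d0.
  have [e e0 fe] := pos_linear_trunc hX lcX pL cf d0.
  rewrite -/(cut f e) in fe.
  pose K := [set x | e <= f x]%R.
  have cK : compact K by exact: Ccplus_level_compact.
  apply: (@le_trans _ _ ((Lam (cut f e))%:E + d%:E)); first by rewrite -EFinD lee_fin.
  rewrite leeD2r//; apply: (@le_trans _ _ (riesz_outer K)); last first.
    apply: ereal_sup_ubound; exists K => //; split => // x /= Kx.
    by apply: contrapT => /(indic_off (fU x)); rewrite leNgt (lt_le_trans e0 Kx).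
  apply: le_ereal_inf_tmp => _ [W [oW KW] <-]; apply: inner_sup_ub; first exact: Ccplus_cut.
  apply: indic_le => x; first by rewrite (le_trans (cut_le _ _ _))// (indic1 (fU x)).
  by move=> Wx; rewrite cut_off// => /KW.
Qed.

Definition riesz : radon R X := Radon riesz_radon.

Let open_le U : open U -> riesz_measure U <= inner_sup Lam (fun x => (\1_U x)%:E).
Proof. by move=> oU; rewrite muE riesz_outer_open. Qed.

(** The layer-cake bound gives one inequality for every l.s.c. function.
    Applied to M 1_V - f, where V is the set where f > 0 and M bounds f, it gives
    the opposite inequality for f, because V has finite measure. *)
Lemma rieszE (f : X -> R) : Ccplus f -> \int[riesz]_x (f x)%:E = (Lam f)%:E.
Proof.
move=> cf; have [_ _ f0] := cf; have [fc _ _] := cf; have [L0 LD LZ] := pL.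
have lf : lower_semicontinuous (fun x => (f x)%:E) by exact: lsc_continuous.
have f0' x : 0 <= (f x)%:E by rewrite lee_fin.
have inner_supE : inner_sup Lam (fun x => (f x)%:E) = (Lam f)%:E.
  apply/eqP; rewrite eq_le; apply/andP; split; last exact: inner_sup_ub.
  apply: ge_ereal_sup => _ [g [cg gf] <-]; rewrite lee_fin.
  by apply: pos_linear_le => // x; rewrite -lee_fin.
apply/eqP; rewrite eq_le; apply/andP; split.
  by rewrite -inner_supE; apply: (@integral_le_inner_sup _ _ _ pL riesz_measure open_le).
have [M M0 fM] := Ccplus_bounded cf.
pose V := [set x | 0 < f x]%R.
have oV : open V by exact: Ccplus_level_open.
have Vfin : riesz V < +oo.
  apply: (@le_lt_trans _ _ (riesz_outer (closure [set x | f x != 0%R]))).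
    by apply: le_riesz_outer => x /= fx; apply: subset_closure => /=; rewrite gt_eqF.
  by apply: outer_compact_lty; case: cf.
pose g x := (M%:E * (\1_V x)%:E - (f x)%:E).
have gE x : g x = (M * \1_V x - f x)%:E by rewrite /g -EFinM -EFinB.
have g0 x : 0 <= g x.
  rewrite gE lee_fin subr_ge0 indicE; case: (boolP (x \in V)) => [_|/negP xV].
    by rewrite mulr1.
  rewrite mulr0 leNgt; apply/negP => fx; apply: xV; exact: mem_set.
have lg : lower_semicontinuous g.
  apply: lscD => [x|x||]; rewrite ?ltNyr//.
    apply: lscZ => //; [exact: ltW|exact: lsc_indic].
  have := @lsc_continuous R X (fun x => - f x)%R; apply => x; apply: cvgN; exact: fc.
have MV : \int[riesz]_x g x + \int[riesz]_x (f x)%:E = M%:E * riesz V.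
  rewrite -ge0_integralD//; last 2 first.
  - exact: lsc_measurable.
  - exact: Ccplus_measurable.
  under eq_integral do rewrite subeK//.
  rewrite ge0_integralZl//; last 2 first.
  - by apply: lsc_measurable; exact: lsc_indic.
  - by rewrite lee_fin ltW.
  by rewrite integral_indic ?setIT//; exact: borel_open.
have CgfV : inner_sup Lam g + (Lam f)%:E <= M%:E * riesz V.
  rewrite -inner_supE; apply: (le_trans (inner_supD pL g0 f0')).
  apply: ge_ereal_sup => _ [h [ch hV] <-].
  rewrite muleC -lee_pdivrMr// -EFinM mulrC -LZ//; last by rewrite invr_ge0 ltW.
  rewrite [riesz V]riesz_outer_open//; apply: inner_sup_ub => [|x].
    by apply: CcplusZ => //; rewrite invr_ge0 ltW.
  rewrite EFinM muleC lee_pdivrMr// muleC.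
  by have := hV x; rewrite subeK.
have Cfin : inner_sup Lam g \is a fin_num.
  rewrite ge0_fin_numE ?inner_sup_ge0//; apply: (@le_lt_trans _ _ (M%:E * riesz V)).
    apply: le_trans CgfV; rewrite leeDl// lee_fin; exact: L0.
  by apply: lte_mul_pinfty => //; rewrite lee_fin ltW.
rewrite -(@leeD2lE _ (inner_sup Lam g))//; apply: (le_trans CgfV); rewrite -MV leeD2r//.
exact: (@integral_le_inner_sup _ _ _ pL riesz_measure open_le).
Qed.

End riesz.

(** * Potentials and energy *)

Section potentials.
Local Open Scope ereal_scope.
Context {R : realType} {X : ptopologicalType}.
Hypotheses (hX : hausdorff_space X) (lcX : locally_compact [set: X]).
Implicit Types (mu nu : radon R X) (m : {measure set (borel X) -> \bar R}).

(** A locally finite Borel measure (a restriction or a combination of Radon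
    measures) need not satisfy the regularity conditions of a Radon measure.  Its
    Radon companion has the same integrals on test functions; integrals of
    l.s.c. functions can only drop, which is the direction in which energies are
    estimated. *)
Lemma regularize m : compact_finite m -> exists mu : radon R X,
  (forall f : X -> R, Ccplus f -> \int[mu]_x (f x)%:E = \int[m]_x (f x)%:E) /\
  (forall g : X -> \bar R, (forall x, 0 <= g x) -> lower_semicontinuous g ->
     \int[mu]_x g x <= \int[m]_x g x).
Proof.
move=> fm; have pL := test_integral_pos_linear fm.
have E (f : X -> R) : Ccplus f -> \int[riesz hX lcX pL]_x (f x)%:E = \int[m]_x (f x)%:E.
  by move=> cf; rewrite rieszE// test_integralE.
exists (riesz hX lcX pL); split => // g g0 lg.
rewrite radon_inner_sup//; apply: le_trans (inner_sup_le_integral fm g0 lg).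
apply: ge_ereal_sup => _ [f [cf fg] <-].
rewrite test_integralE//; last exact: radon_compact_finite.
by rewrite E// -test_integralE//; exact: inner_sup_ub.
Qed.

Lemma test_integral_continuous (f : X -> R) : Ccplus f ->
  continuous (fun nu : radon R X => test_integral nu f).
Proof.
move=> cf nu; have [fc fs _] := cf; pose phi := TestFun fc fs.
have h1 : {for nu, continuous (@vague_eval R X)}.
  exact: (@initial_continuous _ _ (@vague_eval R X)).
have h2 : {for vague_eval nu, continuous
    (fun p : prod_topology (fun _ : test_fun R X => R) => p phi)}.
  have /cvg_sup/(_ phi) h : nbhs (vague_eval nu) --> vague_eval nu by exact: cvg_id.
  move=> U Unu; apply: h.
  exact: (@initial_continuous _ _ (fun p : (forall _ : test_fun R X, R) => p phi)).
exact: (continuous_comp h1 h2).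
Qed.

Lemma vague_near mu (f : X -> R) (a : R) : Ccplus f -> a%:E < \int[mu]_x (f x)%:E ->
  nbhs mu [set nu : radon R X | a%:E < \int[nu]_x (f x)%:E].
Proof.
move=> cf amu.
have cE nu : (test_integral nu f)%:E = \int[nu]_x (f x)%:E by apply: test_integralE => //; exact: radon_compact_finite.
move: amu; rewrite -cE lte_fin => amu.
have H : nbhs mu [set nu : radon R X | (a < test_integral nu f)%R].
  exact: (cvgr_gt (test_integral mu f) (@test_integral_continuous f cf mu) _ amu).
by apply: filterS H => nu h; rewrite /= -cE lte_fin.
Qed.

Lemma vague_near_lt mu (f : X -> R) (a : R) : Ccplus f -> \int[mu]_x (f x)%:E < a%:E ->
  nbhs mu [set nu : radon R X | \int[nu]_x (f x)%:E < a%:E].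
Proof.
move=> cf amu.
have cE nu : (test_integral nu f)%:E = \int[nu]_x (f x)%:E by apply: test_integralE => //; exact: radon_compact_finite.
move: amu; rewrite -cE lte_fin => amu.
have H : nbhs mu [set nu : radon R X | (test_integral nu f < a)%R].
  exact: (cvgr_lt (test_integral mu f) (@test_integral_continuous f cf mu) _ amu).
by apply: filterS H => nu h; rewrite /= -cE lte_fin.
Qed.

Lemma vague_cvg (F : set_system (radon R X)) mu : Filter F ->
  (forall phi : test_fun R X, (fun nu : radon R X => vague_eval nu phi) @ F --> vague_eval mu phi) ->
  F --> mu.
Proof.
move=> FF h A; rewrite nbhsE => -[_ [[B oB <-] Bmu] BA].
have vF : @vague_eval R X @ F --> vague_eval mu.
  apply/cvg_sup => phi V [_ [[W oW <-] Wp] WV].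
  have hW : F [set nu | W (vague_eval nu phi)] := h phi W (open_nbhs_nbhs (conj oW Wp)).
  by suff : F [set nu | V (vague_eval nu)] by []; apply: filterS hW => nu Wnu; exact: WV.
have hB : F [set nu | B (vague_eval nu)] := vF B (open_nbhs_nbhs (conj oB Bmu)).
by suff : F A by []; apply: filterS hB => nu; exact: BA.
Qed.

Variables (G : X -> X -> \bar R) (Gk : potential_kernel G).

Let G0 x y : 0 <= G x y. Proof. by have [] := Gk. Qed.

Lemma kernel_lsc x : lower_semicontinuous (G x).
Proof.
have [_ lG _ _] := Gk => y a ay; have [V [[A B] [/= Ax By] AB] VG] := lG (x, y) a ay.
by exists B => // z Bz; apply: (VG (x, z)); apply: AB; split => //=; exact: nbhs_singleton.
Qed.

Lemma potential_ge0 mu x : 0 <= potential G mu x.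
Proof. by apply: integral_ge0 => y _; exact: G0. Qed.

(** Lower semicontinuity of G on the product gives a neighbourhood of x0 for each
    point y; compactness of the support of f makes it uniform in y. *)
Lemma kernel_tube x0 (f : X -> R) (e : R) : Ccplus f -> (0 < e)%R ->
  (forall y, (f y)%:E <= G x0 y) ->
  \forall x \near x0, forall y, (Num.max (f y - e) 0)%:E <= G x y.
Proof.
move=> cf e0 fG; have [fc fs f0] := cf.
pose P (A : set X) := nbhs x0 [set x | forall y, A y -> (f y - e)%:E <= G x y].
have H : P (closure [set x | f x != 0%R]).
  apply: (compact_induction fs).
  - by rewrite /P; apply: filterS (@filterT _ (nbhs x0) _) => x _ y [].
  - by rewrite /P => A B PA PB; apply: filterS (filterI PA PB) => x [hA hB] y [/hA|/hB].
  - by rewrite /P => A B AB; apply: filterS => x h y /AB; exact: h.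
  - move=> y _; have [_ lG _ _] := Gk.
    have [|V [[A B] [/= Ax By] AB] VG] := lG (x0, y) (f y - e / 2)%R.
      by apply: lt_le_trans (fG y); rewrite lte_fin ltrBlDr ltrDl divr_gt0.
    exists (B `&` [set z | f z < f y + e / 2]%R).
      apply: filterI => //; apply: (cvgr_lt (f y) (fc y)).
      by rewrite ltrDl divr_gt0.
    apply: filterS Ax => x Ax z [Bz fz].
    have : (f y - e / 2)%:E < G x z by apply: (VG (x, z)); exact: AB.
    move=> /ltW; apply: le_trans; rewrite lee_fin; move: fz; rewrite /=; lra.
rewrite /P in H; apply: filterS H => x h y; rewrite EFin_max ge_max G0 andbT.
have [fy|fy] := eqVneq (f y) 0%R.
  by apply: le_trans (G0 x y); rewrite fy sub0r lee_fin oppr_le0 ltW.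
by apply: h; exact: subset_closure.
Qed.

Lemma potential_lower mu x0 (a : R) : a%:E < potential G mu x0 ->
  exists f : X -> R, [/\ Ccplus f, a%:E < \int[mu]_y (f y)%:E &
    \forall x \near x0, forall y, (f y)%:E <= G x y].
Proof.
move=> amu; have [f [e [cf e0 fG afe]]] := radon_lsc_approx hX lcX (G0 x0) (@kernel_lsc x0) amu.
exists (fun y => Num.max (f y - e) 0)%R; split => //; first exact: Ccplus_trunc.
exact: kernel_tube.
Qed.

Lemma le_potential mu (f : X -> R) x : Ccplus f -> (forall y, (f y)%:E <= G x y) ->
  \int[mu]_y (f y)%:E <= potential G mu x.
Proof.
move=> cf fG; apply: ge0_le_integral => //.
- by move=> y _; rewrite lee_fin; case: cf.
- exact: Ccplus_measurable.
- exact: (lsc_measurable (@kernel_lsc x)).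
Qed.

Lemma potential_lsc mu : lower_semicontinuous (potential G mu).
Proof.
move=> x0 a /potential_lower[f [cf af fG]].
exists [set x | forall y, (f y)%:E <= G x y] => // x h.
by apply: (lt_le_trans af); exact: le_potential.
Qed.

Lemma potential_measurable mu : measurable_fun [set: borel X] (potential G mu).
Proof. by apply: lsc_measurable; exact: potential_lsc. Qed.

(** Tonelli's theorem for an l.s.c. kernel.  The general theorem does not apply:
    without a countable base an open subset of X * X may fail to belong to the
    product of the Borel sigma-algebras, and the measures may fail to be
    sigma-finite.  Instead, approximate the potential of mu from below by a test
    function t.  Near each point x of the compact set that carries t, some test
    function h satisfies h(y) <= G z y for all z near x, and its mu-integral
    exceeds t; on such a piece B the inequality only involves the product
    nu(B) h(y).  The pieces are glued along disjoint Borel sets. *)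
Lemma potential_sym_le mu nu :
  \int[nu]_x potential G mu x <= \int[mu]_y potential G nu y.
Proof.
apply: lee_real_ltP => a /(radon_lsc_approx hX lcX (potential_ge0 mu) (@potential_lsc mu)).
move=> [f [e [cf e0 fG afe]]]; have [fc fs f0] := cf.
apply: ltW; apply: (lt_le_trans afe).
pose t x : R := (Num.max (f x - e) 0)%R; rewrite -/(t _).
have ct : Ccplus t by exact: Ccplus_trunc.
have t0 x : (0 <= t x)%R by case: ct.
pose K := [set x | e <= f x]%R.
have cK : compact K by exact: Ccplus_level_compact.
pose P (A : set X) := exists2 A' : set X, measurable (A' : set (borel X)) /\ A `<=` A' &
  forall B : set X, measurable (B : set (borel X)) -> B `<=` A' ->
  exists k : X -> \bar R, [/\ forall y, 0 <= k y, measurable_fun [set: borel X] k,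
    (forall y, k y <= \int[nu]_(x in (B : set (borel X))) G x y) &
    \int[nu]_(x in (B : set (borel X))) (t x)%:E <= \int[mu]_y k y].
have mG y : measurable_fun [set: borel X] (fun x => G x y).
  have [_ _ Gs _] := Gk.
  by rewrite (_ : (fun x => G x y) = G y); [exact: (lsc_measurable (@kernel_lsc y))|apply/funext => x; exact: Gs].
have mt : measurable_fun [set: borel X] (fun x => (t x)%:E) by exact: Ccplus_measurable.
have [||||K' [mK' KK'] KP] := compact_induction (P := P) cK.
- exists set0; first by split; [exact: measurable0|].
  move=> B _ B0; exists (fun=> 0); split => //.
  + by move=> y; apply: integral_ge0.
  + by rewrite (_ : B = set0) ?integral_set0 ?integral0//; apply/seteqP; split.
- move=> A1 A2 [A1' [mA1 sA1] PA1] [A2' [mA2 sA2] PA2]; exists (A1' `|` A2').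
    by split; [exact: measurableU|exact: setUSS].
  move=> B mB BA.
  have mB1 : measurable (B `&` A1' : set (borel X)) by exact: measurableI.
  have mB2 : measurable (B `\` A1' : set (borel X)) by exact: measurableD.
  have BE : B = (B `&` A1') `|` (B `\` A1') by rewrite setUIDK.
  have [k1 [k10 mk1 k1G k1t]] := PA1 _ mB1 (@subIsetr _ _ _).
  have [|k2 [k20 mk2 k2G k2t]] := PA2 _ mB2.
    by move=> x [/BA[|//]] h /(_ h).
  have dB : [disjoint (B `&` A1') & (B `\` A1')].
    by apply/disj_setPS => x [[_ ?] [_ ?]].
  exists (fun y => k1 y + k2 y); split.
  + by move=> y; exact: adde_ge0.
  + exact: emeasurable_funD.
  + move=> y; rewrite [X in \int[nu]_(x in X) _]BE ge0_integral_setU//; first exact: leeD.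
    by apply: measurable_funTS; exact: mG.
  + rewrite [X in \int[nu]_(x in X) _]BE ge0_integral_setU//; last 2 first.
    * by apply: measurable_funTS.
    * by move=> x _; rewrite lee_fin.
    by rewrite ge0_integralD//; exact: leeD.
- move=> A1 A2 A12 [A' [mA' A2A'] PA]; exists A' => //; split => //.
  exact: subset_trans A2A'.
- move=> x /= Kx.
  have [|h [ch ch1 hG]] := @potential_lower mu x (t x).
    apply: lt_le_trans (fG x); rewrite lte_fin /t gt_max gtrBl e0 /=.
    exact: lt_le_trans Kx.
  have [W [Wx WG]] : exists W : set X, open_nbhs x W /\
      forall z, W z -> (t z)%:E <= \int[mu]_y (h y)%:E /\ forall y, (h y)%:E <= G z y.
    have : nbhs x ([set z | forall y, (h y)%:E <= G z y] `&` [set z | (t z)%:E <= \int[mu]_y (h y)%:E]).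
      apply: filterI => //.
      have hf : \int[mu]_y (h y)%:E \is a fin_num.
        by rewrite ge0_fin_numE ?Ccplus_integral_ge0//; apply: compact_finite_Ccplus_lty => //; exact: radon_compact_finite.
      have [tc _ _] := ct; rewrite -(fineK hf).
      have : nbhs x [set z | t z < fine (\int[mu]_y (h y)%:E)]%R.
        apply: (cvgr_lt (t x) (tc x)); rewrite -lte_fin fineK//.
      by apply: filterS => z /= /ltW; rewrite -lee_fin.
    rewrite nbhsE => -[W Wx WG]; exists W; split => // z /WG[]; by [].
  have mW : measurable (W : set (borel X)) by apply: borel_open; case: Wx.
  exists W; first by apply: open_nbhs_nbhs.
  exists W; first by split.
  move=> B mB BW.
  have hnn y : 0 <= (h y)%:E by rewrite lee_fin; case: ch.
  exists (fun y => (h y)%:E * nu B); split.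
  + by move=> y; exact: mule_ge0.
  + by apply: emeasurable_funM => //; exact: Ccplus_measurable.
  + move=> y; rewrite -integral_cst//; apply: ge0_le_integral => //.
    * by move=> z _; exact: hnn.
    * by apply: measurable_funTS; exact: mG.
    * by move=> z Bz; have [_] := WG z (BW z Bz); exact.
  + rewrite ge0_integralZr//; [|exact: Ccplus_measurable].
    rewrite -integral_cst//; apply: ge0_le_integral => //.
    * by move=> z _; rewrite lee_fin.
    * exact: measurable_funTS.
    * by move=> z Bz; have [] := WG z (BW z Bz).
have clK : closed K by exact: Ccplus_level_closed.
have mK : measurable (K : set (borel X)) by exact: borel_closed.
have [k [k0 mk kG kt]] := KP K mK KK'.
apply: (@le_trans _ _ (\int[nu]_(x in (K : set (borel X))) (t x)%:E)).
  rewrite le_eqVlt; apply/orP; left; apply/eqP.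
  rewrite [RHS]integral_mkcond; apply: eq_integral => x _.
  rewrite patchE; case: (boolP (x \in K)) => // /negP xK; congr (_%:E); apply/max_idPr.
  by rewrite subr_le0 leNgt; apply/negP => /ltW h; apply: xK; exact: mem_set.
apply: (le_trans kt); apply: ge0_le_integral => //; first exact: potential_measurable.
move=> y _; apply: (le_trans (kG y)); have [_ _ Gs _] := Gk.
rewrite /potential; under [leRHS]eq_integral do rewrite Gs.
by apply: ge0_subset_integral => //; exact: mG.
Qed.

Lemma potential_sym mu nu :
  \int[nu]_x potential G mu x = \int[mu]_y potential G nu y.
Proof. by apply/eqP; rewrite eq_le !potential_sym_le. Qed.

Definition energy mu : \bar R := \int[mu]_x potential G mu x.

Lemma energy_ge0 mu : 0 <= energy mu.
Proof. by apply: integral_ge0 => x _; exact: potential_ge0. Qed.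

(** Below the potential of mu lies a truncated test function t with integral
    still larger than a.  For nu near mu the potential of nu remains above t on
    the compact set that carries t, hence everywhere, and the integral of t
    against nu remains larger than a. *)
Lemma energy_lsc mu (a : R) : a%:E < energy mu ->
  nbhs mu [set nu : radon R X | a%:E < energy nu].
Proof.
move=> /(radon_lsc_approx hX lcX (potential_ge0 mu) (@potential_lsc mu)).
move=> [f [e [cf e0 fG afe]]]; have [fc fs f0] := cf.
pose t x : R := (Num.max (f x - e) 0)%R; rewrite -/(t _) in afe.
have ct : Ccplus t by exact: Ccplus_trunc.
have tc : continuous t by case: ct.
pose K := [set x | e <= f x]%R.
have cK : compact K by exact: Ccplus_level_compact.
pose P (A : set X) := nbhs mu [set nu : radon R X |
    forall x, A x -> (t x)%:E <= potential G nu x].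
have H : P K.
  apply: (compact_induction cK).
  - by rewrite /P; apply: filterS (@filterT _ (nbhs mu) _) => nu _ x [].
  - by rewrite /P => A B PA PB; apply: filterS (filterI PA PB) => nu [hA hB] x [/hA|/hB].
  - by rewrite /P => A B AB; apply: filterS => nu h x /AB; exact: h.
  - move=> x Kx.
    have [c [tc1 cG]] : exists c : R, (t x < c)%R /\ c%:E < potential G mu x.
      exists (f x - e / 2)%R; split; last first.
        by apply: lt_le_trans (fG x); rewrite lte_fin ltrBlDr ltrDl divr_gt0.
      have {}Kx : (e <= f x)%R := Kx; rewrite /t gt_max; apply/andP; split; lra.
    have [h [ch ch1 hG]] := @potential_lower mu x c cG.
    exists ([set z | forall y, (h y)%:E <= G z y] `&` [set z | t z < c]%R).
      by apply: filterI => //; apply: (cvgr_lt (t x) (tc x)).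
    apply: filterS (vague_near ch ch1) => nu cnu z [zG tz].
    apply: (@le_trans _ _ c%:E); first by rewrite lee_fin ltW.
    by apply: (le_trans (ltW cnu)); exact: le_potential.
rewrite /P in H; apply: filterS (filterI H (vague_near ct afe)) => nu [tG anu].
apply: (lt_le_trans anu); apply: ge0_le_integral => //.
- by move=> x _; rewrite lee_fin; case: ct.
- exact: Ccplus_measurable.
- exact: potential_measurable.
move=> x _; have [Kx|Kx] := pselect (K x); first exact: tG.
rewrite /t (_ : Num.max _ _ = 0%R) ?potential_ge0//.
by apply/max_idPr; rewrite subr_le0 leNgt; apply/negP => /ltW.
Qed.

End potentials.

(** * Minima and limits by compactness *)

Section lsc_min.
Context {R : realType} {T : topologicalType}.

(** If no minimum were attained, finitely many points of K would have values
    such that every point of K exceeds one of them; the smallest of these values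
    would be strictly less than itself. *)
Lemma compact_lsc_min (K : set T) (J : T -> R) : compact K -> K !=set0 ->
  (forall x a, K x -> a < J x -> exists2 V, nbhs x V & forall y, V y -> K y -> a < J y) ->
  exists2 x, K x & forall y, K y -> J x <= J y.
Proof.
move=> cK [k Kk] lJ; apply: contrapT => nmin.
pose P (A : set T) := exists2 y, K y & forall x, A x -> K x -> J y < J x.
have [||||y Ky yJ] := compact_induction (P := P) cK.
- by exists k.
- move=> A B [y Ky yA] [z Kz zB]; have [yz|zy] := leP (J y) (J z).
    by exists y => // x [Ax|Bx] Kx; [exact: yA|apply: (le_lt_trans yz); exact: zB].
  by exists z => // x [Ax|Bx] Kx; [apply: (lt_trans zy); exact: yA|exact: zB].
- by move=> A B AB [y Ky yB]; exists y => // x /AB; exact: yB.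
- move=> x Kx; have [y Ky yx] : exists2 y, K y & J y < J x.
    apply: contrapT => h; apply: nmin; exists x => // y Ky.
    by rewrite leNgt; apply/negP => yx; apply: h; exists y.
  by have [V Vx VJ] := lJ x (J y) Kx yx; exists V => //; exists y.
by have := yJ y Ky Ky; rewrite ltxx.
Qed.

Lemma ultra_bounded_cvg (T' : Type) (F : set_system T') (f : T' -> R) (C : R) : UltraFilter F ->
  F [set x | 0 <= f x <= C] -> exists l : R, f x @[x --> F] --> l.
Proof.
move=> UF FC; have [|l [_ cl]] := @segment_compact R 0 C (f @ F) _ _.
  suff : F [set x | (`[0, C]%classic : set R) (f x)] by [].
  by apply: filterS FC => x h; rewrite /= in_itv.
exists l => U Ul; have [//|nU] := in_ultra_setVsetC (f @^-1` U) UF.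
by have [y [nUy Uy]] := cl (~` U) U nU Ul.
Qed.

End lsc_min.

(** * Integrals of u.s.c. functions of compact support *)

Section semicontinuous_test.
Local Open Scope ereal_scope.
Context {R : realType} {X : ptopologicalType}.
Hypotheses (hX : hausdorff_space X) (lcX : locally_compact [set: X]).
Implicit Types (mu nu : radon R X) (m : {measure set (borel X) -> \bar R}) (h : X -> \bar R).

Lemma H0_fin h x : H0 h -> h x \is a fin_num.
Proof. by move=> [/(_ x)/andP[h0 hy] _ _]; rewrite ge0_fin_numE. Qed.

Lemma H0_ge0 h x : H0 h -> 0 <= h x.
Proof. by move=> [/(_ x)/andP[]]. Qed.

Lemma H0_measurable h : H0 h -> measurable_fun [set: borel X] h.
Proof. by move=> [_ uh _]; exact: usc_measurable. Qed.

Lemma Ccplus_H0 (f : X -> R) : Ccplus f -> H0 (fun x => (f x)%:E).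
Proof.
move=> [fc fs f0]; split.
- by move=> x; rewrite lee_fin f0 ltry.
- have := @lsc_continuous R X (fun x => - f x)%R; apply => x; apply: cvgN; exact: fc.
- by apply: compact_supportS fs => x; rewrite -eqe.
Qed.

Lemma H0_dom h : H0 h -> exists2 f : X -> R, Ccplus f & forall x, h x <= (f x)%:E.
Proof.
move=> Hh; have [h0 uh sh] := Hh.
pose P (A : set X) := exists2 M : R, (0 < M)%R & forall x, A x -> h x <= M%:E.
have [||||M M0 hM] := compact_induction (P := P) sh.
- by exists 1%R.
- move=> A B [M M0 hM] [N N0 hN]; exists (M + N)%R; first exact: addr_gt0.
  by move=> x [/hM|/hN] /le_trans; apply; rewrite lee_fin ?lerDl ?lerDr ltW.
- by move=> A B AB [M M0 hM]; exists M => // x /AB/hM.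
- move=> x _; have hx := H0_fin x Hh.
  have hx0 : (0 <= fine (h x))%R by rewrite fine_ge0//; exact: H0_ge0.
  have [|V Vx hV] := uh x (- (fine (h x) + 1))%R.
    by rewrite -(fineK hx) -EFinN lte_fin ltrN2 ltrDl.
  exists V => //; exists (fine (h x) + 1)%R; first by rewrite ltr_wpDl.
  by move=> y /hV; rewrite EFinN lteN2 => /ltW.
have [c [cc _ _ cK]] : exists c : X -> R, [/\ Ccplus c, forall y, (c y <= 1)%R,
    forall y, ~ setT y -> c y = 0%R & forall y, closure [set x | h x != 0%R] y -> c y = 1%R].
  by apply: urysohn_compact => //; exact: openT.
exists (fun x => M * c x)%R; first by apply: CcplusZ => //; exact: ltW.
move=> x; have [->|hx] := eqVneq (h x) 0.
  by rewrite lee_fin; apply: mulr_ge0; [exact: ltW|case: cc].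
by rewrite cK ?mulr1; [apply: hM|]; exact: subset_closure.
Qed.

Lemma H0_integral_lty mu h : H0 h -> \int[mu]_x h x < +oo.
Proof.
move=> Hh; have [f cf hf] := H0_dom Hh.
apply: le_lt_trans (compact_finite_Ccplus_lty (@radon_compact_finite R X mu) cf).
apply: ge0_le_integral => //.
- by move=> x _; exact: H0_ge0.
- exact: H0_measurable.
- exact: Ccplus_measurable.
Qed.

Lemma H0_integral_ge0 mu h : H0 h -> 0 <= \int[mu]_x h x.
Proof. by move=> Hh; apply: integral_ge0 => x _; exact: H0_ge0. Qed.

Lemma H0_integral_fin mu h : H0 h -> \int[mu]_x h x \is a fin_num.
Proof. by move=> Hh; rewrite ge0_fin_numE ?H0_integral_ge0// H0_integral_lty. Qed.

(** For a test function f >= h, the difference f - h is l.s.c.; a test function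
    below f - h with nearly the same integral is subtracted from f. *)
Lemma H0_approx mu h (a : R) : H0 h -> \int[mu]_x h x < a%:E ->
  exists f : X -> R, [/\ Ccplus f, forall x, h x <= (f x)%:E & \int[mu]_x (f x)%:E < a%:E].
Proof.
move=> Hh ha; have [f cf hf] := H0_dom Hh; have [_ uh _] := Hh; have [fc _ f0] := cf.
pose g x := (f x)%:E - h x.
have g0 x : 0 <= g x by rewrite /g sube_ge0// H0_fin.
have lg : lower_semicontinuous g.
  apply: lscD => [x|x||]; rewrite ?ltNyr//.
    by rewrite -(fineK (H0_fin x Hh)) -EFinN ltNyr.
  exact: lsc_continuous.
have gh : \int[mu]_x g x + \int[mu]_x h x = \int[mu]_x (f x)%:E.
  rewrite -ge0_integralD//.
  - by apply: eq_integral => x _; rewrite /g subeK// H0_fin.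
  - exact: lsc_measurable.
  - by move=> x _; exact: H0_ge0.
  - exact: H0_measurable.
have fl : \int[mu]_x (f x)%:E \is a fin_num.
  by rewrite ge0_fin_numE ?Ccplus_integral_ge0//; apply: compact_finite_Ccplus_lty => //; exact: radon_compact_finite.
have hl := H0_integral_fin mu Hh.
have gl : \int[mu]_x g x = \int[mu]_x (f x)%:E - \int[mu]_x h x by rewrite -gh addeK.
have [|k [e [ck e0 kg ak]]] := @radon_lsc_approx R X hX lcX mu g
   (fine (\int[mu]_x (f x)%:E) - a)%R g0 lg.
  rewrite gl EFinB fineK//; move: ha; rewrite -(fineK hl) -(fineK fl) -EFinB !lte_fin; lra.
pose t x := Num.max (k x - e)%R 0%R.
have ct : Ccplus t by exact: Ccplus_trunc.
have tg x : (t x)%:E <= g x.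
  by rewrite /t EFin_max ge_max g0 andbT (le_trans _ (kg x))// lee_fin gerBl ltW.
have tf x : (t x <= f x)%R.
  rewrite -lee_fin (le_trans (tg x))// /g -(fineK (H0_fin x Hh)) -EFinB lee_fin gerBl.
  by rewrite fine_ge0// H0_ge0.
have cft : Ccplus (fun x => f x - t x)%R by exact: CcplusB.
exists (fun x => f x - t x)%R; split => //.
- move=> x; have := tg x; rewrite /g -(fineK (H0_fin x Hh)) -EFinB !lee_fin; lra.
- have [_ LD _] := test_integral_pos_linear (@radon_compact_finite R X mu).
  have mE (u : X -> R) : Ccplus u -> \int[mu]_x (u x)%:E = (test_integral mu u)%:E.
    by move=> cu; rewrite test_integralE//; exact: radon_compact_finite.
  have ftE : test_integral mu f = (test_integral mu (fun x => f x - t x) + test_integral mu t)%R.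
    by rewrite -LD//; congr test_integral; apply/funext => x; rewrite subrK.
  move: ak; rewrite -/(t _) !mE// !lte_fin /=; lra.
Qed.

Lemma H0_usc mu h (a : R) : H0 h -> \int[mu]_x h x < a%:E ->
  nbhs mu [set nu : radon R X | \int[nu]_x h x < a%:E].
Proof.
move=> Hh /(H0_approx Hh)[f [cf hf fa]].
apply: filterS (vague_near_lt cf fa) => nu; apply: le_lt_trans.
apply: ge0_le_integral => //.
- by move=> x _; exact: H0_ge0.
- exact: H0_measurable.
- exact: Ccplus_measurable.
Qed.

(** Dual to the estimate of regularize: integrals over H0 can only grow. *)
Lemma regularize_H0 m mu h : (forall f : X -> R, Ccplus f -> \int[mu]_x (f x)%:E = \int[m]_x (f x)%:E) ->
  H0 h -> \int[m]_x h x <= \int[mu]_x h x.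
Proof.
move=> mE Hh; have hl := H0_integral_fin mu Hh.
apply/lee_addgt0Pr => e e0.
have [|f [cf hf fa]] := @H0_approx mu h (fine (\int[mu]_x h x) + e)%R Hh.
  by rewrite EFinD fineK// lteDl// lte_fin.
apply: (@le_trans _ _ (\int[m]_x (f x)%:E)).
  apply: ge0_le_integral => //.
  - by move=> x _; exact: H0_ge0.
  - exact: H0_measurable.
  - exact: Ccplus_measurable.
by rewrite -mE// ltW// -(fineK hl).
Qed.

(** The measure s (mu + t nu), up to regularization: the two inequalities are
    those by which its energy is bounded above and its integral over H0 below. *)
Lemma radon_comb mu nu (s t : R) : (0 <= s)%R -> (0 <= t)%R ->
  exists kappa : radon R X,
  (forall g : X -> \bar R, (forall x, 0 <= g x) -> lower_semicontinuous g ->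
     \int[kappa]_x g x <= s%:E * (\int[mu]_x g x + t%:E * \int[nu]_x g x)) /\
  (forall h, H0 h -> s%:E * (\int[mu]_x h x + t%:E * \int[nu]_x h x) <= \int[kappa]_x h x).
Proof.
move=> s0 t0.
pose m : {measure set (borel X) -> \bar R} := mscale (NngNum s0) (measure_add mu (mscale (NngNum t0) nu)).
have mE (g : X -> \bar R) : (forall x, 0 <= g x) -> measurable_fun [set: borel X] g ->
    \int[m]_x g x = s%:E * (\int[mu]_x g x + t%:E * \int[nu]_x g x).
  move=> g0 mg; rewrite ge0_integral_mscale//=; congr (_ * _).
  by rewrite ge0_integral_measure_add//= ge0_integral_mscale.
have fm : compact_finite m.
  move=> K cK; rewrite [m K](_ : _ = s%:E * (mu K + t%:E * nu K)).
    2: exact: (congr1 (fun z => s%:E * z) (measure_addE mu (mscale (NngNum t0) nu) (K : set (borel X)))).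
  apply: lte_mul_pinfty; [by rewrite lee_fin|by []|].
  apply: lte_add_pinfty; first exact: radon_compact_finite.
  by apply: lte_mul_pinfty; [rewrite lee_fin|by []|exact: radon_compact_finite].
have [kappa [kE kle]] := regularize hX lcX fm; exists kappa; split.
- by move=> g g0 lg; rewrite -mE//; [exact: kle|exact: lsc_measurable].
- move=> h Hh; rewrite -mE; first exact: regularize_H0.
    by move=> x; exact: H0_ge0.
  exact: H0_measurable.
Qed.

(** The restriction of nu to B, up to regularization, as in radon_comb. *)
Lemma radon_restr nu (B : set X) : measurable (B : set (borel X)) ->
  exists kappa : radon R X,
  (forall g : X -> \bar R, (forall x, 0 <= g x) -> lower_semicontinuous g ->
     \int[kappa]_x g x <= \int[nu]_(x in (B : set (borel X))) g x) /\
  (forall h, H0 h -> \int[nu]_(x in (B : set (borel X))) h x <= \int[kappa]_x h x).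
Proof.
move=> mB; pose m : {measure set (borel X) -> \bar R} := mrestr nu mB.
have mE (g : X -> \bar R) : (forall x, 0 <= g x) -> measurable_fun [set: borel X] g ->
    \int[m]_x g x = \int[nu]_(x in (B : set (borel X))) g x.
  move=> g0 mg; have mCB : measurable (~` B : set (borel X)) by exact: measurableC.
  rewrite -(setUv B) ge0_integral_setU//; last 2 first.
  - by rewrite setUv.
  - by apply/disj_setPCl.
  rewrite [X in _ + X](_ : _ = 0) ?adde0; last first.
    apply: null_set_integral => //; first exact: measurable_funTS.
    by rewrite /m /= /mrestr setICl measure0.
  apply: eq_measure_integral => A mA AB; rewrite /m /= /mrestr.
  by congr (radon_measure nu _); exact/setIidl.
have fm : compact_finite m.
  move=> K cK; apply: le_lt_trans (@radon_compact_finite R X nu K cK).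
  have mK : measurable (K : set (borel X)) by apply: borel_closed; exact: compact_closed.
  by rewrite /m /= /mrestr; apply: le_measure; rewrite ?inE//; exact: measurableI.
have [kappa [kE kle]] := regularize hX lcX fm; exists kappa; split.
- by move=> g g0 lg; rewrite -mE//; [exact: kle|exact: lsc_measurable].
- move=> h Hh; rewrite -mE; first exact: regularize_H0.
    by move=> x; exact: H0_ge0.
  exact: H0_measurable.
Qed.

End semicontinuous_test.

(** * Vague compactness of the energy unit ball *)

Section unit_ball.
Local Open Scope ereal_scope.
Context {R : realType} {X : ptopologicalType}.
Hypotheses (hX : hausdorff_space X) (lcX : locally_compact [set: X]).
Implicit Types (mu nu : radon R X) (h : X -> \bar R).
Variables (G : X -> X -> \bar R) (Gk : potential_kernel G).

Let G0 x y : 0 <= G x y. Proof. by have [] := Gk. Qed.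

Lemma energy_le1P mu : energy_le1 G mu <-> energy G mu <= 1.
Proof.
rewrite /energy_le1 /enorm /= -/(energy G mu).
have s1 : sqrte 1 = 1 :> \bar R by rewrite /= sqrtr1.
by rewrite -{1}s1 lee_sqrt.
Qed.

(** As G > d > 0 on U * U for some neighbourhood U of x, the energy of mu is at
    least d times the square of the mass of U. *)
Lemma energy_local_mass (x : X) : exists2 U : set X, open_nbhs x U &
  exists C : R, forall mu, energy G mu <= 1 -> mu U <= C%:E.
Proof.
have [_ lG _ Gd] := Gk.
have [d d0 dG] : exists2 d : R, (0 < d)%R & d%:E < G x x.
  move: (Gd x); case: (G x x) => [r| |]//; last by exists 1%R; rewrite ?ltry.
  by rewrite lte_fin => r0; exists (r / 2)%R; rewrite ?lte_fin; lra.
have [V [[A B] [/= Ax Bx] AB] VG] := lG (x, x) d dG.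
have : nbhs x (A `&` B) by exact: filterI.
rewrite nbhsE => -[U oU UAB]; exists U => //.
have mU : measurable (U : set (borel X)) by apply: borel_open; case: oU.
have GU y z : U y -> U z -> d%:E <= G y z.
  by move=> /UAB[Ay _] /UAB[_ Bz]; apply: ltW; apply: (VG (y, z)); exact: AB.
(* any constant whose square exceeds 1/d would do; here d (1 + 1/d)^2 = d + 2 + 1/d *)
exists (1 + d^-1)%R => mu emu; rewrite leNgt; apply/negP => muU.
have d1 : (0 < d^-1)%R by rewrite invr_gt0.
suff : 1 < energy G mu by rewrite ltNge emu.
apply: (@lt_le_trans _ _ (\int[mu]_(x in (U : set (borel X))) (d * (1 + d^-1))%:E)).
  rewrite integral_cst//; apply: (@lt_le_trans _ _ ((d * (1 + d^-1))%:E * (1 + d^-1)%:E)).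
    have dd : (d * d^-1 = 1)%R by rewrite mulfV// gt_eqF.
    have e1 : (d * (1 + d^-1) = d + 1)%R by rewrite mulrDr mulr1 dd.
    by rewrite -EFinM lte_fin e1 mulrDr mulr1 mulrDl dd mul1r; lra.
  by apply: lee_wpmul2l; [rewrite lee_fin mulr_ge0 ?addr_ge0// ltW|exact: ltW].
apply: (@le_trans _ _ (\int[mu]_(x in (U : set (borel X))) potential G mu x)); last first.
  apply: ge0_subset_integral => //; first exact: potential_measurable.
  by move=> y _; exact: potential_ge0.
apply: ge0_le_integral => //.
- by move=> y _; rewrite lee_fin mulr_ge0 ?addr_ge0// ltW.
- by apply: measurable_funTS; exact: potential_measurable.
move=> y Uy; apply: (@le_trans _ _ (\int[mu]_(z in (U : set (borel X))) d%:E)).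
  rewrite integral_cst// EFinM; apply: lee_wpmul2l; [by rewrite lee_fin ltW|exact: ltW].
apply: (@le_trans _ _ (\int[mu]_(z in (U : set (borel X))) G y z)).
  apply: ge0_le_integral => //.
  - by move=> z _; rewrite lee_fin ltW.
  - by apply: measurable_funTS; exact: (lsc_measurable (kernel_lsc Gk (x := y))).
  - by move=> z Uz; exact: GU.
apply: ge0_subset_integral => //.
exact: (lsc_measurable (kernel_lsc Gk (x := y))).
Qed.

Lemma energy_test_bound (f : X -> R) : Ccplus f ->
  exists2 C : R, (0 <= C)%R & forall mu, energy G mu <= 1 -> \int[mu]_x (f x)%:E <= C%:E.
Proof.
move=> cf; have [fc sf f0] := cf.
pose P (A : set X) := exists2 A' : set X, measurable (A' : set (borel X)) /\ A `<=` A' &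
  exists2 C : R, (0 <= C)%R & forall mu, energy G mu <= 1 -> mu A' <= C%:E.
have [||||K [mK sK] [C C0 CK]] := compact_induction (P := P) sf.
- exists set0; first by split; [exact: measurable0|].
  by exists 0%R => // mu _; rewrite measure0.
- move=> A B [A' [mA sA] [C C0 CA]] [B' [mB sB] [D D0 DB]]; exists (A' `|` B').
    by split; [exact: measurableU|exact: setUSS].
  exists (C + D)%R; first exact: addr_ge0.
  move=> mu emu; apply: (@le_trans _ _ (mu A' + mu B')).
    exact: measureU2.
  by rewrite EFinD; apply: leeD; [exact: CA|exact: DB].
- move=> A B AB [B' [mB sB] CB]; exists B' => //; split => //.
  exact: subset_trans sB.
- move=> x _; have [U oU [C CU]] := energy_local_mass x.
  exists U; first exact: open_nbhs_nbhs.
  exists U; first by split => //; apply: borel_open; case: oU.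
  exists (Num.max C 0)%R; first by rewrite le_max lexx orbT.
  by move=> mu /CU /le_trans; apply; rewrite lee_fin le_max lexx.
have [M M0 fM] := Ccplus_bounded cf.
exists (M * C)%R; first by apply: mulr_ge0 => //; exact: ltW.
move=> mu emu; apply: (@le_trans _ _ (\int[mu]_x (M%:E * (\1_K x)%:E))).
  apply: ge0_le_integral => //.
  - by move=> x _; rewrite lee_fin.
  - exact: Ccplus_measurable.
  - by apply: measurable_funeM; apply/measurable_EFinP; exact: measurable_indic.
  - move=> x _; rewrite -EFinM lee_fin; have [->|fx] := eqVneq (f x) 0%R.
      by apply: mulr_ge0 => //; exact: ltW.
    by rewrite indicE mem_set ?mulr1//; apply: sK; exact: subset_closure.
rewrite ge0_integralZl//; last 2 first.
- by apply/measurable_EFinP; exact: measurable_indic.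
- by rewrite lee_fin ltW.
rewrite integral_indic// setIT EFinM; apply: lee_wpmul2l; first by rewrite lee_fin ltW.
exact: CK.
Qed.

Lemma test_fun_Ccplus (phi : test_fun R X) :
  Ccplus (fun x => Num.max (phi x) 0)%R /\ Ccplus (fun x => Num.max (- phi x) 0)%R.
Proof.
have pc := @test_continuous _ _ phi; have ps := @test_support _ _ phi.
split; (split; last by move=> x; rewrite le_max lexx orbT).
- apply: (@max_fun_continuous _ _ R _ (fun=> 0%R)) => // x; exact: cvg_cst.
- by apply: compact_supportS ps => x; apply: contra_neq => ->; rewrite maxxx.
- apply: (@max_fun_continuous _ _ R _ (fun=> 0%R)) => x; last exact: cvg_cst.
  by apply: cvgN; exact: pc.
- by apply: compact_supportS ps => x; apply: contra_neq => ->; rewrite oppr0 maxxx.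
Qed.

(** The vague topology is generated by test functions of variable sign, whereas
    linear forms are handled on the cone of nonnegative ones. *)
Lemma vague_evalE mu (phi : test_fun R X) : vague_eval mu phi =
  (test_integral mu (fun x => Num.max (phi x) 0) - test_integral mu (fun x => Num.max (- phi x) 0))%R.
Proof.
have [cp cn] := test_fun_Ccplus phi.
have mF := @radon_compact_finite R X mu.
have Fp : \int[mu]_x (EFin \o phi)^\+ x = (test_integral mu (fun x => Num.max (phi x) 0%R))%:E.
  by rewrite (test_integralE mF cp); apply: eq_integral => x _; rewrite funeposE /= EFin_max.
have Fn : \int[mu]_x (EFin \o phi)^\- x = (test_integral mu (fun x => Num.max (- phi x) 0%R))%:E.
  by rewrite (test_integralE mF cn); apply: eq_integral => x _; rewrite funenegE /= EFin_max EFinN.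
by rewrite /vague_eval /Rintegral integralE Fp Fn.
Qed.

(** Along an ultrafilter on the ball, the integrals of each test function are
    bounded, hence converge.  The limits form a positive linear form, represented
    by a Radon measure; the ultrafilter converges to it, and lower semicontinuity
    of the energy keeps it in the ball. *)
Theorem energy_le1_compact : compact (energy_le1 G : set (radon R X)).
Proof.
rewrite compact_ultra => F UF FE.
have {}FE : F [set mu | energy G mu <= 1] by apply: filterS FE => mu /energy_le1P.
have cvgL (f : X -> R) : Ccplus f -> exists l : R, (fun mu : radon R X => test_integral mu f) @ F --> l.
  move=> cf; have [C C0 CE] := energy_test_bound cf.
  apply: (@ultra_bounded_cvg _ _ _ _ C) => //.
  apply: filterS FE => mu /CE; rewrite -test_integralE// ?lee_fin; last exact: radon_compact_finite.
  by move=> h /=; rewrite h andbT; have [-> //] := test_integral_pos_linear (@radon_compact_finite R X mu).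
pose Lam f : R := lim ((fun mu : radon R X => test_integral mu f) @ F).
have LamE f : Ccplus f -> (fun mu : radon R X => test_integral mu f) @ F --> Lam f.
  by move=> cf; have [l hl] := cvgL f cf; apply/cvg_ex; exists l.
have Luniq f l : (fun mu : radon R X => test_integral mu f) @ F --> (l : R) -> Lam f = l.
  by move=> h; apply/cvg_lim.
have pL : pos_linear Lam.
  split.
  - move=> f cf; apply: limr_ge; first by apply/cvg_ex; exists (Lam f); exact: LamE.
    apply: filterS (@filterT _ F _) => mu _.
    by have [-> //] := test_integral_pos_linear (@radon_compact_finite R X mu).
  - move=> f g cf cg; apply: Luniq.
    rewrite (_ : (fun mu : radon R X => _) = (fun mu => test_integral mu f + test_integral mu g)%R).
      by apply: cvgD; exact: LamE.
    by apply/funext => mu; have [_ -> //] := test_integral_pos_linear (@radon_compact_finite R X mu).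
  - move=> c f c0 cf; apply: Luniq.
    rewrite (_ : (fun mu : radon R X => _) = (fun mu => c * test_integral mu f)%R).
      by apply: cvgM; [exact: cvg_cst|exact: LamE].
    by apply/funext => mu; have [_ _ -> //] := test_integral_pos_linear (@radon_compact_finite R X mu).
pose mu := riesz hX lcX pL.
have muE f : Ccplus f -> test_integral mu f = Lam f.
  by move=> cf; apply: EFin_inj; rewrite test_integralE ?rieszE//; exact: radon_compact_finite.
have Fmu : F --> mu.
  apply: vague_cvg => phi.
  rewrite (_ : (fun nu : radon R X => _) = (fun nu =>
    test_integral nu (fun x => Num.max (phi x) 0) - test_integral nu (fun x => Num.max (- phi x) 0))%R); last first.
    by apply/funext => nu; rewrite vague_evalE.
  have [cp cn] := test_fun_Ccplus phi.
  by rewrite vague_evalE; apply: cvgB; rewrite muE//; exact: LamE.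
exists mu; split => //; apply/energy_le1P; rewrite leNgt; apply/negP => emu.
have := Fmu _ (energy_lsc hX lcX Gk emu).
move=> /(filterI FE) /filter_ex [nu [/= h1 h2]].
by move: (lt_le_trans h2 h1); rewrite ltxx.
Qed.

End unit_ball.

(** * Domination by a potential *)

Section consistent_kernel.
Local Open Scope ereal_scope.
Context {R : realType} {X : ptopologicalType}.
Hypotheses (hX : hausdorff_space X) (lcX : locally_compact [set: X]).
Implicit Types (mu nu lam u : radon R X) (h : X -> \bar R).
Variables (G : X -> X -> \bar R) (Gk : potential_kernel G).

Let K1 : compact (energy_le1 G : set (radon R X)) := energy_le1_compact hX lcX Gk.

Lemma H0_max h h' : H0 h -> H0 h' -> H0 (fun x => maxe (h x) (h' x)).
Proof.
move=> Hh Hh'; have [b u s] := Hh; have [b' u' s'] := Hh'; split.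
- move=> x; have /andP[h0 hy] := b x; have /andP[h0' hy'] := b' x.
  by rewrite le_max h0 gt_max hy hy'.
- rewrite /upper_semicontinuous (_ : (fun x => _) = (fun x => mine (- h x) (- h' x))).
    exact: lsc_min.
  by apply/funext => x; rewrite oppe_max.
- apply: compact_supportU s s' => x; have [->|] := eqVneq (h x) 0; last by left.
  have [->|] := eqVneq (h' x) 0; last by right.
  by rewrite maxxx eqxx.
Qed.

Lemma H0_scale h (c : R) : (0 <= c)%R -> H0 h -> H0 (fun x => c%:E * h x).
Proof.
move=> c0 Hh; have [b uh s] := Hh; split.
- move=> x; rewrite mule_ge0 ?lee_fin//; last exact: H0_ge0.
  by rewrite -(fineK (H0_fin x Hh)) -EFinM ltry.
- rewrite /upper_semicontinuous => x a.
  move: c0; rewrite le_eqVlt => /predU1P[<-|c0].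
    rewrite mul0e oppe0 => a0; exists setT; first exact: filterT.
    by move=> y _; rewrite mul0e oppe0.
  move=> ax; have [|V Vx hV] := uh x (c^-1 * a)%R.
    move: ax; rewrite -(fineK (H0_fin x Hh)) -EFinM -!EFinN !lte_fin.
    by rewrite [(c^-1 * a)%R]mulrC ltr_pdivrMr// mulNr [(fine _ * c)%R]mulrC.
  exists V => // y /hV; rewrite -(fineK (H0_fin y Hh)) -EFinM -!EFinN !lte_fin.
  by rewrite [(c^-1 * a)%R]mulrC ltr_pdivrMr// mulNr [(fine _ * c)%R]mulrC.
- by apply: compact_supportS s => x; apply: contra_neq => ->; rewrite mule0.
Qed.

Lemma H00 : H0 (fun _ : X => 0 : \bar R).
Proof. exact: (Ccplus_H0 Ccplus0). Qed.

(** A Dini argument on the ball: a test function above h whose integral is below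
    c at mu stays so near mu, and the minimum of finitely many of them works on
    the whole ball. *)
Lemma H0_dini h (c : R) : H0 h -> (forall mu, energy_le1 G mu -> \int[mu]_x h x < c%:E) ->
  exists f : X -> R, [/\ Ccplus f, forall x, h x <= (f x)%:E &
    forall mu, energy_le1 G mu -> \int[mu]_x (f x)%:E < c%:E].
Proof.
move=> Hh hc.
pose P (A : set (radon R X)) := exists f : X -> R, [/\ Ccplus f, forall x, h x <= (f x)%:E &
    forall mu, A mu -> \int[mu]_x (f x)%:E < c%:E].
suff : P (energy_le1 G) by [].
apply: (compact_induction K1); rewrite /P.
- by have [f cf hf] := H0_dom hX lcX Hh; exists f.
- move=> A B [f [cf hf fA]] [g [cg hg gB]]; exists (fun x => Num.min (f x) (g x)).
  have cm : Ccplus (fun x => Num.min (f x) (g x)).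
    by case: cg => ? ? ?; exact: Ccplus_min.
  split => //.
    by move=> x; rewrite EFin_min le_min hf hg.
  have le_int mu (k : X -> R) : Ccplus k -> (forall x, Num.min (f x) (g x) <= k x)%R ->
      \int[mu]_x (Num.min (f x) (g x))%:E <= \int[mu]_x (k x)%:E.
    move=> ck mk; apply: ge0_le_integral => //.
    - by move=> x _; rewrite lee_fin; case: cm.
    - exact: Ccplus_measurable.
    - exact: Ccplus_measurable.
    - by move=> x _; rewrite lee_fin.
  move=> mu [/fA|/gB]; apply: le_lt_trans; apply: le_int => // x; rewrite ge_min lexx ?orbT//.
- by move=> A B AB [f [cf hf fB]]; exists f; split => // mu /AB/fB.
- move=> mu /hc /(H0_approx hX lcX Hh)[f [cf hf fc]].
  exists [set nu : radon R X | \int[nu]_x (f x)%:E < c%:E]; first exact: vague_near_lt.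
  by exists f.
Qed.

Hypotheses (Gc : consistent G) (Gp : positive_definite G).

Lemma energy_le1_finite mu : energy_le1 G mu -> finite_energy G mu.
Proof. by rewrite /energy_le1 /finite_energy /= => /le_lt_trans; apply; rewrite ltry. Qed.

Definition mutual_energy mu nu : \bar R := \int[nu]_x potential G mu x.

Lemma mutual_energy_ge0 mu nu : 0 <= mutual_energy mu nu.
Proof. by apply: integral_ge0 => x _; exact: potential_ge0. Qed.

Lemma mutual_energy_le1 mu nu : energy_le1 G mu -> energy_le1 G nu -> mutual_energy mu nu <= 1.
Proof.
move=> m1 n1; apply: (le_trans (Gp (energy_le1_finite m1) (energy_le1_finite n1))).
by rewrite -[leRHS]mule1; apply: lee_pmul => //; exact: sqrte_ge0.
Qed.

Lemma mutual_energy_fin mu nu : energy_le1 G mu -> energy_le1 G nu -> mutual_energy mu nu \is a fin_num.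
Proof.
move=> m1 n1; rewrite ge0_fin_numE ?mutual_energy_ge0//.
by apply: (le_lt_trans (mutual_energy_le1 m1 n1)); rewrite ltry.
Qed.

(** The form in which consistency is used: upper semicontinuity on the ball. *)
Lemma mutual_energy_near_lt lam mu (c : \bar R) : energy_le1 G lam -> energy_le1 G mu ->
  mutual_energy lam mu < c ->
  nbhs mu [set nu : radon R X | energy_le1 G nu -> mutual_energy lam nu < c].
Proof.
move=> l1 m1 mc; have [_ /subspace_continuousP /(_ mu m1)] := Gc (energy_le1_finite l1).
move=> /(_ [set y | y < c]); apply.
by apply: open_nbhs_nbhs; split => //; exact: open_ereal_lt_ereal.
Qed.

(** The same argument from below: near each mu of the ball, consistency bounds
    the integral of G u from above, while a test function below G u keeps its
    integral; maxima of finitely many test functions work on the whole ball. *)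
Lemma potential_dini u (e : R) : energy_le1 G u -> (0 < e)%R ->
  exists f : X -> R, [/\ Ccplus f, forall x, (f x)%:E <= potential G u x &
    forall mu, energy_le1 G mu -> mutual_energy u mu <= \int[mu]_x (f x)%:E + e%:E].
Proof.
move=> u1 e0.
pose P (A : set (radon R X)) := exists f : X -> R, [/\ Ccplus f,
  forall x, (f x)%:E <= potential G u x &
  forall mu, A mu -> energy_le1 G mu -> mutual_energy u mu <= \int[mu]_x (f x)%:E + e%:E].
suff [f [cf fG fe]] : P (energy_le1 G) by exists f; split => // mu m1; exact: fe.
apply: (compact_induction K1); rewrite /P.
- by exists (fun=> 0%R); split => // [|x]; [exact: Ccplus0|exact: potential_ge0].
- move=> A B [f [cf hf fA]] [g [cg hg gB]]; exists (fun x => Num.max (f x) (g x)).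
  have cm : Ccplus (fun x => Num.max (f x) (g x)) by exact: Ccplus_max.
  split => //.
    by move=> x; rewrite EFin_max ge_max hf hg.
  have le_int mu (k : X -> R) : Ccplus k -> (forall x, k x <= Num.max (f x) (g x))%R ->
      \int[mu]_x (k x)%:E <= \int[mu]_x (Num.max (f x) (g x))%:E.
    move=> ck mk; apply: ge0_le_integral => //.
    - by move=> x _; rewrite lee_fin; case: ck.
    - exact: Ccplus_measurable.
    - exact: Ccplus_measurable.
    - by move=> x _; rewrite lee_fin.
  move=> mu [/fA h|/gB h] m1; apply: (le_trans (h m1)); rewrite leeD2r//; apply: le_int => // x.
    by rewrite le_max lexx.
  by rewrite le_max lexx orbT.
- by move=> A B AB [f [cf hf fB]]; exists f; split => // mu /AB/fB.
- move=> mu m1; have mf := mutual_energy_fin u1 m1.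
  have [|f [d [cf d0 fG fm]]] := @radon_lsc_approx R X hX lcX mu (potential G u)
      (fine (mutual_energy u mu) - e / 2)%R (potential_ge0 Gk u) (@potential_lsc R X hX lcX G Gk u).
    by rewrite -/(mutual_energy u mu) -[ltRHS](fineK mf) lte_fin ltrBlDr ltrDl divr_gt0.
  have ct : Ccplus (fun x => Num.max (f x - d) 0)%R by exact: Ccplus_trunc.
  have fm' : mutual_energy u mu < (fine (mutual_energy u mu) + e / 2)%:E.
    by rewrite -[ltLHS](fineK mf) lte_fin ltrDl divr_gt0.
  exists ([set nu : radon R X | (fine (mutual_energy u mu) - e / 2)%:E < \int[nu]_x (Num.max (f x - d) 0)%:E] `&`
      [set nu : radon R X | energy_le1 G nu -> mutual_energy u nu < (fine (mutual_energy u mu) + e / 2)%:E]).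
    by apply: filterI; [exact: vague_near|exact: mutual_energy_near_lt].
  exists (fun x => Num.max (f x - d) 0)%R; split => //.
    move=> x; rewrite EFin_max ge_max potential_ge0// andbT.
    by apply: le_trans (fG x); rewrite lee_fin gerBl ltW.
  move=> nu [h1 h2] n1; apply: (le_trans (ltW (h2 n1))).
  rewrite [X in X%:E](_ : _ = (fine (mutual_energy u mu) - e / 2) + e)%R; last by lra.
  by rewrite EFinD leeD2r// ltW.
Qed.

Lemma mutual_energyC lam nu : mutual_energy lam nu = mutual_energy nu lam.
Proof. exact: potential_sym. Qed.

(** Only an inequality is known for kappa; it is applied to the potential of
    kappa, and, after exchanging the two measures by symmetry of G, to the
    potentials of lam and nu. *)
Lemma comb_energy lam nu (kappa : radon R X) (s t : R) : (0 <= s)%R -> (0 <= t)%R ->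
  (forall g : X -> \bar R, (forall x, 0 <= g x) -> lower_semicontinuous g ->
     \int[kappa]_x g x <= s%:E * (\int[lam]_x g x + t%:E * \int[nu]_x g x)) ->
  energy G kappa <= s%:E * (s%:E * (energy G lam + t%:E * mutual_energy lam nu) +
     t%:E * (s%:E * (mutual_energy lam nu + t%:E * energy G nu))).
Proof.
move=> s0 t0 H; have P0 := potential_ge0 Gk; have Pl := @potential_lsc R X hX lcX G Gk.
apply: (le_trans (H _ (P0 kappa) (Pl kappa))).
apply: lee_wpmul2l; first by rewrite lee_fin.
apply: leeD.
  rewrite -/(mutual_energy kappa lam) mutual_energyC; apply: (le_trans (H _ (P0 lam) (Pl lam))).
  by [].
apply: lee_wpmul2l; first by rewrite lee_fin.
rewrite -/(mutual_energy kappa nu) mutual_energyC; apply: (le_trans (H _ (P0 nu) (Pl nu))).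
by rewrite -/(mutual_energy nu lam) mutual_energyC.
Qed.

Lemma energy_le1_nonempty : (energy_le1 G : set (radon R X)) !=set0.
Proof.
have [|mu [_ mule]] := @regularize R X hX lcX mzero; first by move=> K _; rewrite ltry.
exists mu; apply/energy_le1P; apply: le_trans (mule _ (potential_ge0 Gk mu) _) _.
  exact: potential_lsc.
by rewrite integral_measure_zero.
Qed.

Lemma energy_fin mu : energy_le1 G mu -> energy G mu \is a fin_num.
Proof. by move=> m1; exact: (mutual_energy_fin m1 m1). Qed.

(** A minimizer lam of J(mu) = (energy of mu)/2 - \int h dmu on the ball exists,
    J being l.s.c.  Comparing lam with lam + t nu, for t tending to 0, gives the
    inequality for nu.  This measure may leave the ball; it is then scaled back
    to norm 1, and J is no smaller before scaling since \int h is at most the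
    norm. *)
Lemma obstacle h : H0 h -> (forall nu, energy_le1 G nu -> \int[nu]_x h x <= 1) ->
  exists2 lam, energy_le1 G lam & forall nu, energy_le1 G nu -> \int[nu]_x h x <= mutual_energy lam nu.
Proof.
move=> Hh h1.
pose J (mu : radon R X) : R := (fine (energy G mu) / 2 - fine (\int[mu]_x h x))%R.
have [lam l1 lmin] : exists2 lam, energy_le1 G lam & forall nu, energy_le1 G nu -> (J lam <= J nu)%R.
  apply: (compact_lsc_min K1 energy_le1_nonempty) => mu a m1 aJ.
  have ef := energy_fin m1; have hf := H0_integral_fin hX lcX mu Hh.
  pose d := ((J mu - a) / 2)%R; have d0 : (0 < d)%R by rewrite divr_gt0// subr_gt0.
  have [e1 e2] : (fine (energy G mu) - d)%:E < energy G mu /\ \int[mu]_x h x < (fine (\int[mu]_x h x) + d)%:E.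
    by rewrite -[X in _ < X /\ _](fineK ef) -[X in _ /\ X < _](fineK hf) !lte_fin gtrBl ltrDl.
  exists ([set nu : radon R X | (fine (energy G mu) - d)%:E < energy G nu] `&`
      [set nu : radon R X | \int[nu]_x h x < (fine (\int[mu]_x h x) + d)%:E]).
    by apply: filterI; [exact: energy_lsc|exact: H0_usc].
  move=> nu [h2 h3] n1.
  have {}h2 : (fine (energy G mu) - d < fine (energy G nu))%R.
    by rewrite -lte_fin fineK// energy_fin.
  have {}h3 : (fine (\int[nu]_x h x) < fine (\int[mu]_x h x) + d)%R.
    by rewrite -lte_fin fineK// H0_integral_fin.
  have JE : (a = J mu - 2 * d)%R by rewrite /d; lra.
  by rewrite JE /J; lra.
exists lam => // nu n1.
have lf := energy_fin l1; have nf := energy_fin n1; have cf := mutual_energy_fin l1 n1.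
have lhf := H0_integral_fin hX lcX lam Hh; have nhf := H0_integral_fin hX lcX nu Hh.
set e := fine (energy G lam) in lf *; set c := fine (mutual_energy lam nu).
pose n := fine (energy G nu); pose I := fine (\int[lam]_x h x); pose i := fine (\int[nu]_x h x).
have eE : energy G lam = e%:E by rewrite fineK.
have cE : mutual_energy lam nu = c%:E by rewrite fineK.
have nE : energy G nu = n%:E by rewrite fineK.
have IE : \int[lam]_x h x = I%:E by rewrite fineK.
have iE : \int[nu]_x h x = i%:E by rewrite fineK.
have e0 : (0 <= e)%R by rewrite -lee_fin -eE energy_ge0.
have c0 : (0 <= c)%R by rewrite -lee_fin -cE mutual_energy_ge0.
have n0 : (0 <= n)%R by rewrite -lee_fin -nE energy_ge0.
have n1' : (n <= 1)%R by rewrite -lee_fin -nE; apply/energy_le1P.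
have I0 : (0 <= I)%R by rewrite -lee_fin -IE H0_integral_ge0.
have i0 : (0 <= i)%R by rewrite -lee_fin -iE H0_integral_ge0.
have step (t : R) : (0 < t)%R -> (t * i <= t * c + t ^+ 2 * n / 2)%R.
  move=> t0; have t0' := ltW t0.
  pose q := (e + 2 * t * c + t ^+ 2 * n)%R.
  have q0 : (0 <= q)%R by rewrite /q !addr_ge0// !mulr_ge0// sqr_ge0.
  (* q is the energy of lam + t nu; dividing that measure by N brings it into the ball *)
  pose N := Num.max 1%R (Num.sqrt q); pose s : R := (N^-1)%R.
  have N1 : (1 <= N)%R by rewrite le_max lexx.
  have N0 : (0 < N)%R by apply: lt_le_trans N1.
  have qN : (q <= N ^+ 2)%R.
    rewrite -(sqr_sqrtr q0) ler_pXn2r ?nnegrE ?sqrtr_ge0//; last exact: ltW.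
    by rewrite le_max lexx orbT.
  have s0 : (0 <= s)%R by rewrite invr_ge0 ltW.
  have [kappa [kg kh]] := @radon_comb R X hX lcX lam nu s t s0 t0'.
  have := comb_energy s0 t0' kg; rewrite eE cE nE !(=^~ EFinM, =^~ EFinD).
  rewrite (_ : (s * _ = s ^+ 2 * q)%R); last by rewrite /q; ring.
  move=> ek.
  have sq1 : (s ^+ 2 * q <= 1)%R by rewrite /s exprVn mulrC ler_pdivrMr ?exprn_gt0// mul1r.
  have k1 : energy_le1 G kappa by apply/energy_le1P; apply: (le_trans ek); rewrite lee_fin.
  have kJ := lmin _ k1.
  have kf := energy_fin k1; have khf := H0_integral_fin hX lcX kappa Hh.
  have {}ek : (fine (energy G kappa) <= s ^+ 2 * q)%R by rewrite -lee_fin fineK.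
  have {}kh : (s * (I + t * i) <= fine (\int[kappa]_x h x))%R.
    by rewrite -lee_fin fineK// EFinM EFinD EFinM -IE -iE; exact: kh.
  have kh1 : (fine (\int[kappa]_x h x) <= 1)%R by rewrite -lee_fin fineK//; exact: h1.
  set Ik := fine (\int[kappa]_x h x) in kJ kh kh1; set ek' := fine (energy G kappa) in kJ ek.
  have wN : (I + t * i <= N * Ik)%R by move: kh; rewrite /s [(N^-1 * _)%R]mulrC ler_pdivrMr// [(Ik * N)%R]mulrC.
  (* J of lam is at most J of lam + t nu; beyond norm 1 this holds because the
     function r |-> r^2 / 2 - r Ik is nondecreasing for r >= 1, as Ik <= 1 *)
  have key : (e / 2 - I <= q / 2 - (I + t * i))%R.
    have [q1|q1] := leP (Num.sqrt q) 1%R.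
      have NE : N = 1%R by rewrite /N; apply/max_idPl.
      have sE : s = 1%R by rewrite /s NE invr1.
      move: kJ ek wN; rewrite /J -/e -/I -/Ik -/ek' NE sE expr1n !mul1r; lra.
    have NE : N = Num.sqrt q by rewrite /N; apply/max_idPr; exact: ltW.
    have qE : (q = N ^+ 2)%R by rewrite NE sqr_sqrtr.
    move: kJ ek wN; rewrite /J -/e -/I -/Ik -/ek'.
    have := sq1; move: kh1 N1; rewrite qE; nra.
  move: key; rewrite /q; lra.
have ic : (i <= c)%R.
  apply/ler_addgt0Pr => d d0; have := step d d0.
  have -> : (d * c + d ^+ 2 * n / 2 = d * (c + d * n / 2))%R by ring.
  rewrite ler_pM2l// => /le_trans; apply; rewrite lerD2l.
  have : (d * n <= d * 1)%R by rewrite ler_pM2l.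
  lra.
by rewrite iE cE lee_fin.
Qed.

(** Suppose that every u of the ball fails for some h and some nu.  By
    consistency, the same h and nu refute all measures near u.  Finitely many h
    then suffice, and their maximum, which is again a member of H0 below f,
    refutes every u; this contradicts obstacle applied to h / C. *)
Lemma dominate (f : X -> \bar R) (C : R) : Fplus f -> (0 < C)%R ->
  (forall h, H0 h -> (forall x, h x <= f x) -> forall mu, energy_le1 G mu -> \int[mu]_x h x <= C%:E) ->
  exists2 u, energy_le1 G u & forall h, H0 h -> (forall x, h x <= f x) ->
    forall nu, energy_le1 G nu -> \int[nu]_x h x <= C%:E * mutual_energy u nu.
Proof.
move=> f0 C0 hC; apply: contrapT => nou.
pose P (A : set (radon R X)) := exists h, [/\ H0 h, forall x, h x <= f x &
  forall u, A u -> energy_le1 G u ->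
    exists2 nu, energy_le1 G nu & C%:E * mutual_energy u nu < \int[nu]_x h x].
have [] : P (energy_le1 G).
  apply: (compact_induction K1); rewrite /P.
  - by exists (fun=> 0); split => //; exact: H00.
  - move=> A B [h [Hh hf hA]] [k [Hk kf kB]]; exists (fun x => maxe (h x) (k x)).
    have Hm := H0_max Hh Hk; split => //.
      by move=> x; rewrite ge_max hf kf.
    have le_int mu l : H0 l -> (forall x, l x <= maxe (h x) (k x)) ->
        \int[mu]_x l x <= \int[mu]_x (maxe (h x) (k x)).
      move=> Hl lm; apply: ge0_le_integral => //.
      - by move=> x _; exact: H0_ge0.
      - exact: H0_measurable.
      - exact: H0_measurable.
    move=> u [/hA H|/kB H] u1; have [nu n1 hn] := H u1; exists nu => //;
      apply: (lt_le_trans hn); apply: le_int => // x; rewrite le_max lexx ?orbT//.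
  - by move=> A B AB [h [Hh hf hB]]; exists h; split => // u /AB/hB.
  - move=> u u1.
    have [h [Hh hf] [nu n1 hn]] : exists2 h, H0 h /\ (forall x, h x <= f x) &
        exists2 nu, energy_le1 G nu & C%:E * mutual_energy u nu < \int[nu]_x h x.
      apply: contrapT => no; apply: nou; exists u => // h Hh hf nu n1.
      rewrite leNgt; apply/negP => hn; apply: no; exists h => //; exists nu => //.
    have hn' : mutual_energy nu u < (\int[nu]_x h x) * (C^-1)%:E.
      by rewrite mutual_energyC lte_pdivlMr// muleC.
    exists [set v | energy_le1 G v -> mutual_energy nu v < (\int[nu]_x h x) * (C^-1)%:E].
      exact: mutual_energy_near_lt.
    exists h; split => // v hv v1; exists nu => //.
    by move: (hv v1); rewrite mutual_energyC lte_pdivlMr// muleC.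
move=> h [Hh hf hu].
have c0 : (0 <= C^-1)%R by rewrite invr_ge0 ltW.
have cE nu : \int[nu]_x (C^-1%:E * h x) = C^-1%:E * \int[nu]_x h x.
  rewrite ge0_integralZl//; first exact: H0_measurable.
  by move=> x _; exact: H0_ge0.
have [|lam l1 lh] := obstacle (H0_scale c0 Hh).
  move=> nu n1; rewrite cE muleC lee_pdivrMr// mul1e; exact: hC.
have [nu n1] := hu lam l1 l1; rewrite ltNge => /negP; apply.
by have := lh nu n1; rewrite cE [X in X <= _]muleC lee_pdivrMr// muleC.
Qed.

(** The hypothesis is tested on the restriction of nu to {h > D}, whose energy is
    at most that of nu. *)
Lemma dominate_ae (D h : X -> \bar R) nu : (forall x, 0 <= D x) -> lower_semicontinuous D ->
  H0 h -> (forall mu, energy_le1 G mu -> \int[mu]_x h x <= \int[mu]_x D x) ->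
  energy_le1 G nu -> \forall x \ae nu, h x <= D x.
Proof.
move=> D0 lD Hh hD n1.
have mD := lsc_measurable lD; have mh := H0_measurable Hh.
pose k (x : X) : \bar R := h x - D x.
have mk : measurable_fun [set: borel X] k by exact: emeasurable_funB.
pose B := [set x | 0 < k x].
have mB : measurable (B : set (borel X)).
  rewrite /B (_ : [set x | _] = [set: borel X] `&` k @^-1` `]0, +oo[%classic).
    by apply: mk => //; exact: emeasurable_itv.
  by rewrite setTI; apply/seteqP; split => x; rewrite /= in_itv /= andbT.
have Dfin x : B x -> D x \is a fin_num.
  rewrite /B /= /k ge0_fin_numE// => kx; rewrite ltNge leye_eq; apply/negP => /eqP Dy.
  by move: kx; rewrite Dy -(fineK (H0_fin x Hh)).
have [kappa [kg kh]] := radon_restr hX lcX nu mB.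
have k1 : energy_le1 G kappa.
  apply/energy_le1P; have P0 := potential_ge0 Gk; have Pl := @potential_lsc R X hX lcX G Gk.
  apply: (le_trans (kg _ (P0 kappa) (Pl kappa))).
  apply: (@le_trans _ _ (mutual_energy kappa nu)).
    by apply: ge0_subset_integral => //; exact: potential_measurable.
  rewrite mutual_energyC; apply: (le_trans (kg _ (P0 nu) (Pl nu))).
  apply: (@le_trans _ _ (energy G nu)); last exact/energy_le1P.
  by apply: ge0_subset_integral => //; exact: potential_measurable.
have hDB : \int[nu]_(x in (B : set (borel X))) h x <= \int[nu]_(x in (B : set (borel X))) D x.
  by apply: (le_trans (kh _ Hh)); apply: (le_trans (hD _ k1)); exact: kg.
have mkB : measurable_fun (B : set (borel X)) k by exact: measurable_funTS.
have mDB : measurable_fun (B : set (borel X)) D by exact: measurable_funTS.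
have mhB : measurable_fun (B : set (borel X)) h by exact: measurable_funTS.
have hE : \int[nu]_(x in (B : set (borel X))) h x =
    \int[nu]_(x in (B : set (borel X))) k x + \int[nu]_(x in (B : set (borel X))) D x.
  rewrite -ge0_integralD//; last by move=> x /ltW.
  by apply: eq_integral => x /set_mem Bx; rewrite /k subeK// Dfin.
have Dl : \int[nu]_(x in (B : set (borel X))) D x \is a fin_num.
  rewrite ge0_fin_numE; last by apply: integral_ge0.
  apply: (@le_lt_trans _ _ (\int[nu]_(x in (B : set (borel X))) h x)).
    by rewrite hE leeDr//; apply: integral_ge0 => x /ltW.
  apply: le_lt_trans (H0_integral_lty hX lcX nu Hh).
  by apply: ge0_subset_integral => //; move=> x _; exact: H0_ge0.
have kB0 : \int[nu]_(x in (B : set (borel X))) `|k x| = 0.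
  transitivity (\int[nu]_(x in (B : set (borel X))) k x).
    by apply: eq_integral => x /set_mem /ltW Bx; rewrite gee0_abs.
  apply/eqP; rewrite eq_le integral_ge0 ?andbT; last by move=> x /ltW.
  by move: hDB; rewrite hE -[leRHS]add0e leeD2rE.
have := (ae_eq_integral_abs nu mB mkB).1 kB0.
apply: filterS => x kx; rewrite leNgt; apply/negP => Dh.
have Bx : B x.
  by rewrite /B /= /k sube_gt0.
by move: (Bx); rewrite /B /= (kx Bx) ltxx.
Qed.

End consistent_kernel.

(** * Capacities of semicontinuous functions *)

Section capacities.
Local Open Scope ereal_scope.
Context {R : realType} {X : ptopologicalType}.
Hypotheses (hX : hausdorff_space X) (lcX : locally_compact [set: X]).
Implicit Types (mu nu lam u : radon R X) (f g h : X -> \bar R).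
Variables (G : X -> X -> \bar R) (Gk : potential_kernel G).

Lemma Ccplus_C0plus (k : X -> R) : Ccplus k -> C0plus (fun x => (k x)%:E).
Proof.
move=> ck; split; last exact: Ccplus_H0.
have [kc _ k0] := ck; split; last exact: lsc_continuous.
by move=> x /=; rewrite lee_fin.
Qed.

(** With cap_G_ge: the capacity of an l.s.c. function is the supremum of its
    integrals over the energy unit ball. *)
Lemma cap_G_le g (c : \bar R) : lscplus g ->
  (forall mu, energy_le1 G mu -> \int[mu]_x g x <= c) -> cap_G G g <= c.
Proof.
move=> [g0 lg] gc; apply: ge_ereal_sup => _ [f [C0f fg] <-].
apply: ge_ereal_sup => _ [mu m1 <-]; apply: le_trans (gc mu m1).
have [[f0 lf] _] := C0f; apply: ge0_le_integral => //.
- exact: lsc_measurable.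
- exact: lsc_measurable.
Qed.

Lemma cap_G_ge g mu : lscplus g -> energy_le1 G mu -> \int[mu]_x g x <= cap_G G g.
Proof.
move=> [g0 lg] m1; rewrite radon_inner_sup//; apply: ge_ereal_sup => _ [k [ck kg] <-].
rewrite test_integralE//; last exact: radon_compact_finite.
apply: (@le_trans _ _ (cap_C G (fun x => (k x)%:E))).
  by apply: ereal_sup_ubound; exists mu.
apply: ereal_sup_ubound; exists (fun x => (k x)%:E) => //; split => //.
exact: Ccplus_C0plus.
Qed.

Lemma cap_G_ge0 g : lscplus g -> 0 <= cap_G G g.
Proof.
move=> lg; have [mu m1] := energy_le1_nonempty hX lcX Gk.
by apply: le_trans (cap_G_ge lg m1); apply: integral_ge0 => x _; case: lg.
Qed.

Lemma cap_upper_ge0 f : 0 <= cap_upper G f.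
Proof. by apply: le_ereal_inf_tmp => _ [g [lg _] <-]; exact: cap_G_ge0. Qed.

Lemma cap_upper_le f g : lscplus g -> (forall x, f x <= g x) -> cap_upper G f <= cap_G G g.
Proof. by move=> lg fg; apply: ereal_inf_lbound; exists g. Qed.

Lemma cap_upper_lt f c : cap_upper G f < c ->
  exists g, [/\ lscplus g, forall x, f x <= g x & cap_G G g < c].
Proof. by move=> /ereal_inf_lt[_ [g [lg fg] <-] gc]; exists g. Qed.

Lemma lscplusD f g : lscplus f -> lscplus g -> lscplus (fun x => f x + g x).
Proof.
move=> [f0 lf] [g0 lg]; split; first by move=> x; exact: adde_ge0.
by apply: lscD => // x; apply: (lt_le_trans ltNy0).
Qed.

Lemma lscplusZ (c : R) g : (0 <= c)%R -> lscplus g -> lscplus (fun x => c%:E * g x).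
Proof.
move=> c0 [g0 lg]; split; first by move=> x; apply: mule_ge0 => //; exact: g0.
exact: lscZ.
Qed.

Lemma lscplus_integralD f g mu : lscplus f -> lscplus g ->
  \int[mu]_x (f x + g x) = \int[mu]_x f x + \int[mu]_x g x.
Proof.
move=> [f0 lf] [g0 lg]; rewrite ge0_integralD//; exact: lsc_measurable.
Qed.

Lemma lscplus_integralZ (c : R) g mu : (0 <= c)%R -> lscplus g ->
  \int[mu]_x (c%:E * g x) = c%:E * \int[mu]_x g x.
Proof. by move=> c0 [g0 lg]; rewrite ge0_integralZl//; exact: lsc_measurable. Qed.

(** With cap_H_ge: the capacity of a member of H0 is also the supremum of its
    integrals over the energy unit ball, by the Dini argument. *)
Lemma cap_H_le h (c : \bar R) : H0 h -> 0 <= c ->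
  (forall mu, energy_le1 G mu -> \int[mu]_x h x <= c) -> cap_H G h <= c.
Proof.
move=> Hh c0 hc; have [->|cy] := eqVneq c +oo; first by rewrite leey.
have cf : c \is a fin_num by rewrite ge0_fin_numE// ltey.
apply/lee_addgt0Pr => e e0.
have [|k [ck hk kc]] := @H0_dini R X hX lcX G Gk h (fine c + e)%R Hh.
  move=> mu m1; apply: (le_lt_trans (hc mu m1)).
  by rewrite -[X in X < _](fineK cf) lte_fin ltrDl.
apply: (@le_trans _ _ (cap_C G (fun x => (k x)%:E))).
  apply: ereal_inf_lbound; exists (fun x => (k x)%:E) => //; split => //.
  exact: Ccplus_C0plus.
apply: ge_ereal_sup => _ [mu m1 <-]; apply: (le_trans (ltW (kc mu m1))).
by rewrite EFinD fineK.
Qed.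

Lemma cap_H_ge h mu : H0 h -> energy_le1 G mu -> \int[mu]_x h x <= cap_H G h.
Proof.
move=> Hh m1; apply: le_ereal_inf_tmp => _ [k [C0k hk] <-].
have [[k0 lk] _] := C0k.
apply: (@le_trans _ _ (\int[mu]_x k x)); last by apply: ereal_sup_ubound; exists mu.
apply: ge0_le_integral => //.
- by move=> x _; exact: H0_ge0.
- exact: H0_measurable.
- exact: lsc_measurable.
Qed.

Lemma cap_lower_le_upper f : cap_lower G f <= cap_upper G f.
Proof.
apply: ge_ereal_sup => _ [h [Hh hf] <-]; apply: le_ereal_inf_tmp => _ [g [lg fg] <-].
apply: cap_H_le => //; first exact: cap_G_ge0.
move=> mu m1; apply: le_trans (cap_G_ge lg m1); have [g0 lg'] := lg.
apply: ge0_le_integral => //.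
- by move=> x _; exact: H0_ge0.
- exact: H0_measurable.
- exact: lsc_measurable.
- by move=> x _; exact: le_trans (fg x).
Qed.

(** The points of V are isolated in this subspace, so the condition bears on the
    points off V only. *)
Lemma usc_subspaceP (V : set X) f : upper_semicontinuous (f : subspace (~` V) -> \bar R) <->
  forall x (a : R), ~ V x -> a%:E < - f x -> nbhs x [set y | ~ V y -> a%:E < - f y].
Proof.
split=> uf x a.
  move=> Vx ax; have [W Wx Wf] := uf x a ax.
  have {}Wx : nbhs_subspace (x : subspace (~` V)) W := Wx.
  rewrite -(@nbhs_subspace_in _ (~` V) x)// in Wx.
  have {}Wx : nbhs x [set y | (~` V) y -> W y] by exact: Wx.
  by apply: filterS Wx => y h Vy; apply: Wf; exact: h.
move=> ax; have [Vx|Vx] := pselect (V x).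
  exists [set x]; last by move=> y ->.
  suff : nbhs_subspace (x : subspace (~` V)) [set x] by [].
  by rewrite -(@nbhs_subspace_out _ (~` V) x)//= => h; exact: h.
exists [set y | a%:E < - f y] => //.
suff : nbhs_subspace (x : subspace (~` V)) [set y | a%:E < - f y] by [].
rewrite -(@nbhs_subspace_in _ (~` V) x)//.
exact: (uf x a Vx ax).
Qed.

Lemma usc_restrict f (C : set X) : (forall x, 0 <= f x) -> closed C ->
  (forall x (a : R), C x -> a%:E < - f x -> nbhs x [set y | C y -> a%:E < - f y]) ->
  upper_semicontinuous (fun x => if x \in C then f x else 0).
Proof.
move=> f0 cC uf x a; case: (boolP (x \in C)) => [/set_mem Cx ax|/negP xC].
  exists [set y | C y -> a%:E < - f y]; first exact: uf.
  move=> y h; case: (boolP (y \in C)) => [/set_mem/h//|_].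
  by apply: (lt_le_trans ax); rewrite leeN2.
move=> a0; exists (~` C).
  apply: open_nbhs_nbhs; split; first exact: closed_openC.
  by move=> Cx; apply: xC; exact: mem_set.
by move=> y Cy; rewrite memNset.
Qed.

Lemma H0_restrict f (k : X -> R) (C : set X) : (forall x, 0 <= f x) -> closed C -> Ccplus k ->
  (forall x, C x -> f x <= (k x)%:E) ->
  (forall x (a : R), C x -> a%:E < - f x -> nbhs x [set y | C y -> a%:E < - f y]) ->
  H0 (fun x => if x \in C then f x else 0).
Proof.
move=> f0 cC ck fk uf; have [_ sk k0] := ck; split; last 1 first.
- apply: compact_supportS sk => x; case: (boolP (x \in C)) => [/set_mem Cx|_]; last by rewrite eqxx.
  by apply: contra_neq => kx; apply/eqP; rewrite eq_le f0 andbT (le_trans (fk x Cx))// kx.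
- move=> x; case: (boolP (x \in C)) => [/set_mem Cx|_]; last by rewrite lexx ltry.
  by rewrite f0 (le_lt_trans (fk x Cx))// ltry.
- exact: usc_restrict.
Qed.

(** * Approximation and capacitability of quasi-u.s.c. functions *)

Hypotheses (Gc : consistent G) (Gp : positive_definite G).

(** Let psi be a test function below the excess of g over phi.  Where psi > 0,
    psi + phi <= g, so the restrictions of psi + phi to the closed sets
    {psi >= 1/(n+1)} are members of H0 below g.  They are dominated by D almost
    everywhere, whence psi + phi <= D almost everywhere, and D integrates to at
    most e more than phi. *)
Lemma lsc_excess g (D : X -> \bar R) (phi : X -> R) (e : R) :
  lscplus g -> lscplus D -> Ccplus phi -> (forall x, (phi x)%:E <= D x) ->
  (forall h, H0 h -> (forall x, h x <= g x) -> forall mu, energy_le1 G mu ->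
     \int[mu]_x h x <= \int[mu]_x D x) ->
  (forall mu, energy_le1 G mu -> \int[mu]_x D x <= \int[mu]_x (phi x)%:E + e%:E) ->
  lscplus (fun x => maxe (g x - (phi x)%:E) 0) /\
  forall mu, energy_le1 G mu -> \int[mu]_x (maxe (g x - (phi x)%:E) 0) <= e%:E.
Proof.
move=> [g0 lg] [D0 lD] cphi phiD gD De; have [phic _ phi0] := cphi.
have lge : lscplus (fun x => maxe (g x - (phi x)%:E) 0).
  split; first by move=> x; rewrite /= le_max lexx orbT.
  apply: lsc_max; last exact: lsc_cst.
  apply: lscD => [x|x|//|]; first by apply: (lt_le_trans ltNy0).
    by rewrite -EFinN ltNyr.
  by have := @lsc_continuous R X (fun x => - phi x)%R; apply => x; apply: cvgN; exact: phic.
split => // mu m1; have [e0' le'] := lge.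
rewrite radon_inner_sup//; apply: ge_ereal_sup => _ [psi [cpsi psig] <-].
rewrite test_integralE//; last exact: radon_compact_finite.
have [psic _ psi0] := cpsi.
have cpp : Ccplus (fun x => psi x + phi x)%R by exact: CcplusD.
have phif : \int[mu]_x (phi x)%:E \is a fin_num.
  by rewrite ge0_fin_numE ?Ccplus_integral_ge0//; apply: compact_finite_Ccplus_lty => //; exact: radon_compact_finite.
rewrite -(@leeD2rE _ (\int[mu]_x (phi x)%:E))// [leRHS]addeC; apply: le_trans (De mu m1).
rewrite -ge0_integralD//; last 4 first.
- by move=> x _; rewrite lee_fin.
- exact: Ccplus_measurable.
- by move=> x _; rewrite lee_fin.
- exact: Ccplus_measurable.
apply: ae_ge0_le_integral => //.
- by move=> x _; rewrite -EFinD lee_fin addr_ge0.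
- exact: (Ccplus_measurable cpp).
- exact: lsc_measurable.
pose C n := [set x | n.+1%:R^-1 <= psi x]%R.
pose h n x : \bar R := if x \in C n then (psi x + phi x)%:E else 0.
have Hh n : H0 (h n).
  apply: (H0_restrict _ _ cpp) => //.
  - by move=> x; rewrite lee_fin addr_ge0.
  - exact: Ccplus_level_closed.
  - move=> x a _; have [_ upp _] := Ccplus_H0 cpp.
    by move=> /upp[V Vx Va]; apply: filterS Vx => y Vy _; exact: Va.
have hg n x : h n x <= g x.
  rewrite /h; case: (boolP (x \in C n)) => [/set_mem Cx|_]; last exact: g0.
  have px : (0 < psi x)%R by apply: lt_le_trans Cx; rewrite invr_gt0.
  have := psig x; rewrite le_max => /orP[|]; last by rewrite lee_fin leNgt px.
  by rewrite leeBrDr// -EFinD.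
have hD n : \forall x \ae mu, h n x <= D x.
  by apply: (dominate_ae hX lcX Gk) => //; exact: gD.
apply: filterS (ae_foralln hD) => x hx _; have [px|px] := ltP 0%R (psi x); last first.
  have -> : psi x = 0%R by apply/eqP; rewrite eq_le px psi0.
  by rewrite add0e.
pose n := Num.truncn (psi x)^-1.
have Cx : C n x.
  rewrite /C /= -[leRHS]invrK lef_pV2 ?posrE ?invr_gt0//.
  by apply: ltW; exact: truncnS_gt.
by have := hx n; rewrite /h mem_set// EFinD.
Qed.

(** Choose an l.s.c. g >= f with capacity at most C and u with C G u dominating
    the members of H0 below g, then phi <= C G u as in potential_dini.  For some
    open set W of small capacity, the function h that vanishes on W and equals
    min(f, phi) elsewhere is a member of H0, and f - h is at most the excess of g
    over phi, plus phi on W. *)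
Lemma quasi_usc_H0star f : Fplus f -> quasi_usc G f -> cap_upper G f < +oo -> H0star G f.
Proof.
move=> f0 qf /cap_upper_lt[g [lg fg gy]].
have [C [C0 gC]] : exists C : R, (0 < C)%R /\ cap_G G g <= C%:E.
  have gf : cap_G G g \is a fin_num by rewrite ge0_fin_numE// cap_G_ge0.
  exists (fine (cap_G G g) + 1)%R; split; first by rewrite ltr_wpDl// fine_ge0// cap_G_ge0.
  by rewrite -[leLHS](fineK gf) lee_fin lerDl.
have [g0 lg'] := lg.
have [|u u1 uh] := @dominate R X hX lcX G Gk Gc Gp g C g0 C0.
  move=> h Hh hg mu m1; apply: le_trans gC; apply: le_trans (cap_G_ge lg m1).
  apply: ge0_le_integral => //.
  - by move=> x _; exact: H0_ge0.
  - exact: H0_measurable.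
  - exact: lsc_measurable.
have Pu : lscplus (potential G u).
  split; [exact: potential_ge0|exact: potential_lsc].
have LD := lscplusZ (ltW C0) Pu.
split => //; apply/eqP; rewrite eq_le; apply/andP; split; last first.
  by apply: le_ereal_inf_tmp => _ [h _ <-]; exact: cap_upper_ge0.
apply/lee_addgt0Pr => e e0; rewrite add0e.
pose e2 : R := (e / 2)%R; have e20 : (0 < e2)%R by rewrite divr_gt0.
have [|k [ck kG kC]] := @potential_dini R X hX lcX G Gk Gc Gp u (e2 / C)%R u1.
  by rewrite divr_gt0.
pose phi x := (C * k x)%R; have cphi : Ccplus phi by apply: CcplusZ => //; exact: ltW.
have [lex exe] : lscplus (fun x => maxe (g x - (phi x)%:E) 0) /\
    forall mu, energy_le1 G mu -> \int[mu]_x (maxe (g x - (phi x)%:E) 0) <= e2%:E.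
  apply: (lsc_excess lg LD cphi).
  - by move=> x; rewrite /phi EFinM; apply: lee_wpmul2l => //; rewrite lee_fin ltW.
  - by move=> h Hh hg mu m1; rewrite lscplus_integralZ//; [exact: uh|exact: ltW].
  - move=> mu m1; rewrite lscplus_integralZ//; last exact: ltW.
    have -> : \int[mu]_x (phi x)%:E = C%:E * \int[mu]_x (k x)%:E.
      have := @lscplus_integralZ C (fun x => (k x)%:E) mu (ltW C0).
      by apply; have [] := Ccplus_C0plus ck.
    apply: (@le_trans _ _ (C%:E * (\int[mu]_x (k x)%:E + (e2 / C)%:E))).
      by apply: lee_wpmul2l; [rewrite lee_fin ltW|exact: kC].
    have kf : \int[mu]_x (k x)%:E \is a fin_num.
      by rewrite ge0_fin_numE ?Ccplus_integral_ge0//; apply: compact_finite_Ccplus_lty => //; exact: radon_compact_finite.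
    by rewrite -(fineK kf) !(=^~ EFinM, =^~ EFinD) lee_fin mulrDr [(C * (e2 / C))%R]mulrCA mulfV ?gt_eqF// mulr1.
have [M M0 phiM] := Ccplus_bounded cphi.
(* M bounds phi and the indicator of W is below 2 gV, so phi 1_W has capacity at
   most 2 M d *)
pose d : R := (e2 / (2 * M))%R; have d0 : (0 < d)%R by rewrite divr_gt0// mulr_gt0.
have [V Vd /usc_subspaceP uV] := qf d d0.
have [gV [lgV VgV gVd]] := cap_upper_lt Vd.
pose W := [set x | (1 / 2)%:E < gV x].
have oW : open W by have [_ /lower_semicontinuousP] := lgV; apply.
have VW x : V x -> W x.
  move=> Vx; apply: lt_le_trans (VgV x); rewrite /indic_ereal indicE mem_set// lte_fin /= mulr1n; lra.
pose F x := mine (f x) (phi x)%:E.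
have [_ _ phi0] := cphi.
have F0 x : 0 <= F x by rewrite /F le_min f0 lee_fin phi0.
have Ff x : F x <= f x by rewrite /F ge_min lexx.
have Fphi x : F x <= (phi x)%:E by rewrite /F ge_min lexx orbT.
pose h x := if x \in ~` W then F x else 0.
have Hh : H0 h.
  apply: (H0_restrict F0 _ cphi) => //; first exact: open_closedC.
  move=> x a Wx; rewrite /F oppe_min lt_max => /orP[ax|ax].
    have nVx : ~ V x by move=> /VW.
    apply: filterS (uV x a nVx ax) => y hy Wy.
    by rewrite oppe_min lt_max hy// => /VW.
  have [_ up _] := Ccplus_H0 cphi; have [U Ux Ua] := up x a ax.
  by apply: filterS Ux => y Uy _; rewrite oppe_min lt_max Ua ?orbT.
have hf x : h x <= f x by rewrite /h; case: ifP => _ //; exact: f0.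
apply: (@le_trans _ _ (cap_upper G (fun x => f x - h x))).
  by apply: ereal_inf_lbound; exists h.
have lV2 : lscplus (fun x => (2 * M)%:E * gV x) by apply: lscplusZ => //; rewrite mulr_ge0// ltW.
apply: (@le_trans _ _ (cap_G G (fun x => maxe (g x - (phi x)%:E) 0 + (2 * M)%:E * gV x))).
  apply: cap_upper_le; first exact: lscplusD.
  move=> x.
  have fF : f x <= F x + maxe (g x - (phi x)%:E) 0.
    rewrite /F; have [_|fphi] := leP (f x) (phi x)%:E; first by rewrite leeDl// le_max lexx orbT.
    rewrite -leeBlDl// le_max; apply/orP; left; rewrite leeD2r//; exact: fg.
  have ex0 : 0 <= maxe (g x - (phi x)%:E) 0 by rewrite le_max lexx orbT.
  rewrite leeBlDr ?H0_fin// /h; case: (boolP (x \in ~` W)) => [_|/negP xW].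
    apply: (le_trans fF); rewrite addeC leeD2r// leeDl//.
    by have [+ _] := lV2; exact.
  have Wx : W x by apply: contrapT => Wx; apply: xW; exact: mem_set.
  rewrite adde0; apply: (le_trans fF); rewrite addeC leeD2l//.
  apply: (le_trans (Fphi x)); apply: (@le_trans _ _ ((2 * M)%:E * (1 / 2)%:E)).
    by rewrite -EFinM lee_fin (le_trans (phiM x))//; lra.
  by apply: lee_wpmul2l; [rewrite lee_fin mulr_ge0// ltW|exact: ltW].
apply: cap_G_le; first exact: lscplusD.
move=> mu m1; rewrite lscplus_integralD// lscplus_integralZ//; last by rewrite mulr_ge0// ltW.
rewrite (_ : e%:E = e2%:E + (2 * M)%:E * d%:E); last first.
  by rewrite -EFinM -EFinD /d mulrCA mulfV ?gt_eqF ?mulr_gt0// mulr1 /e2 -splitr.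
apply: leeD; first exact: exe.
apply: lee_wpmul2l; first by rewrite lee_fin mulr_ge0// ltW.
exact: le_trans (cap_G_ge lgV m1) (ltW gVd).
Qed.

(** Each point lies in a base element with compact closure; finite unions of
    such closures exhaust X. *)
Lemma second_countable_exhaustion : @second_countable X ->
  exists K : nat -> set X, (forall n, compact (K n)) /\
    forall x, exists N, forall n, (N <= n)%N -> K n x.
Proof.
move=> [B cB [oB bB]].
have Bx x : exists U, [/\ B U, U x & compact (closure U)].
  have [K Kx [cK clK]] := lc_compact_nbhs lcX x.
  have [U [BU Ux] UK] := bB x K Kx; exists U; split => //.
  apply: (subclosed_compact _ cK); first exact: closed_closure.
  by rewrite [K in _ `<=` K](closure_id K).1//; exact: closureS.
have [f fB] : exists f : nat -> set X, forall U, B U -> exists n, f n = U.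
  move: cB => /pfcard_geP[B0|[f]].
    by exists (fun=> set0) => U; rewrite B0.
  exists f => U BU; have [n _ fn] := 'surj_f BU; by exists n.
pose L n := if pselect (compact (closure (f n))) is left _ then closure (f n) else set0.
have cL n : compact (L n) by rewrite /L; case: pselect => // _; exact: compact0.
exists (fun n => \big[setU/set0]_(k < n.+1) L k); split.
  by move=> n; apply: bigsetU_compact.
move=> x; have [U [BU Ux cU]] := Bx x; have [N fN] := fB U BU; exists N => n Nn.
rewrite -bigcup_mkord; exists N => //=; rewrite /L; case: pselect; last by rewrite fN.
by move=> _; rewrite fN; exact: subset_closure.
Qed.

(** Truncation at n keeps upper semicontinuity, and so does extension by 0 off a
    closed set, since the function is nonnegative. *)
Lemma quasi_usc_min f (K : set X) (n : nat) : Fplus f -> compact K -> quasi_usc G f ->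
  quasi_usc G (fun x => if x \in K then mine (f x) n%:R%:E else 0).
Proof.
move=> f0 cK qf e e0; have [V Ve uV] := qf e e0; exists V => //.
have clK : closed K by exact: compact_closed.
have n0 : (0 : \bar R) <= n%:R%:E by rewrite lee_fin.
apply/usc_subspaceP => x a Vx; case: (boolP (x \in K)) => [/set_mem Kx|/negP xK].
  rewrite oppe_min lt_max => ax.
  have H : nbhs x [set y | ~ V y -> a%:E < - mine (f y) n%:R%:E].
    case/orP: ax => ax.
      have /usc_subspaceP/(_ x a Vx ax) := uV.
      by apply: filterS => y h Vy; rewrite oppe_min lt_max h.
    by apply: filterS (@filterT _ (nbhs x) _) => y _ _; rewrite oppe_min lt_max ax orbT.
  apply: filterS H => y h Vy; case: (boolP (y \in K)) => [_|yK]; first exact: h.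
  by apply: (lt_le_trans (h Vy)); rewrite leeN2 le_min n0 f0.
move=> a0; have : nbhs x (~` K).
  apply: open_nbhs_nbhs; split; first exact: closed_openC.
  by move=> Kx; apply: xK; exact: mem_set.
by apply: filterS => y Ky _; rewrite memNset.
Qed.

Lemma cap_upper_bounded f (K : set X) (n : nat) : compact K ->
  (forall x, f x <= if x \in K then n%:R%:E else 0) -> cap_upper G f < +oo.
Proof.
move=> cK fK.
have [c [cc _ _ cK1]] : exists c : X -> R, [/\ Ccplus c, forall y, (c y <= 1)%R,
    forall y, ~ setT y -> c y = 0%R & forall y, K y -> c y = 1%R].
  by apply: urysohn_compact => //; exact: openT.
have cn : Ccplus (fun x => n%:R * c x)%R by exact: CcplusZ.
have [C C0 CE] := energy_test_bound hX lcX Gk cn.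
have [ln _] := Ccplus_C0plus cn.
apply: (@le_lt_trans _ _ C%:E); last by rewrite ltry.
apply: (@le_trans _ _ (cap_G G (fun x => (n%:R * c x)%:E))).
  apply: cap_upper_le => // x; apply: (le_trans (fK x)).
  case: (boolP (x \in K)) => [/set_mem Kx|_]; rewrite lee_fin; first by rewrite cK1// mulr1.
  by case: cn.
by apply: cap_G_le => // mu /energy_le1P; exact: CE.
Qed.

(** If the inner capacity is finite, a strict upper bound C of it bounds the
    integrals over the energy unit ball of all members of H0 below f, so that one
    potential C G u dominates them all; the truncations of f are approximated by
    such members. *)
Lemma quasi_usc_capacitable f : Fplus f -> quasi_usc G f -> @second_countable X ->
  cap_upper G f = cap_lower G f.
Proof.
move=> f0 qf sc; apply/eqP; rewrite eq_le cap_lower_le_upper andbT.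
have [->|cy] := eqVneq (cap_lower G f) +oo; first by rewrite leey.
have cge h : H0 h -> (forall x, h x <= f x) -> cap_H G h <= cap_lower G f.
  by move=> Hh hf; apply: ereal_sup_ubound; exists h.
have c0 : 0 <= cap_lower G f.
  have [mu m1] := energy_le1_nonempty hX lcX Gk.
  apply: le_trans (cge _ H00 f0); apply: le_trans (cap_H_ge H00 m1).
  by apply: integral_ge0.
have cf : cap_lower G f \is a fin_num by rewrite ge0_fin_numE// ltey.
apply/lee_addgt0Pr => e e0.
pose e2 : R := (e / 2)%R; have e20 : (0 < e2)%R by rewrite divr_gt0.
pose C : R := (fine (cap_lower G f) + e2)%R.
have C0 : (0 < C)%R by rewrite ltr_wpDl// fine_ge0.
have [|u u1 uh] := @dominate R X hX lcX G Gk Gc Gp f C f0 C0.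
  move=> h Hh hf mu m1; apply: (le_trans (cap_H_ge Hh m1)); apply: (le_trans (cge h Hh hf)).
  by rewrite -[leLHS](fineK cf) lee_fin lerDl ltW.
have Pu : lscplus (potential G u) by split; [exact: potential_ge0|exact: potential_lsc].
pose D x := C%:E * potential G u x.
have LD : lscplus D := lscplusZ (ltW C0) Pu.
have [D0 lD] := LD.
have hD h mu : H0 h -> (forall x, h x <= f x) -> energy_le1 G mu -> \int[mu]_x h x <= \int[mu]_x D x.
  by move=> Hh hf m1; rewrite lscplus_integralZ//; [exact: uh|exact: ltW].
have [K [cK Kcov]] := second_countable_exhaustion sc.
pose F n (x : X) : \bar R := if x \in K n then mine (f x) n%:R%:E else 0.
have f0' x : 0 <= f x := f0 x.
have F0 n x : 0 <= F n x by rewrite /F; case: ifP => _ //; rewrite le_min f0' lee_fin /=.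
have Ff n x : F n x <= f x by rewrite /F; case: ifP => _; [rewrite ge_min lexx|exact: f0].
have HF n : H0star G (F n).
  apply: quasi_usc_H0star; [exact: F0|exact: quasi_usc_min|].
  apply: (cap_upper_bounded (cK n) (n := n)) => x; rewrite /F.
  by case: ifP => _ //; rewrite ge_min lexx orbT.
(* F n is within d/2, in capacity, of a member h of H0; as h is at most C G u
   almost everywhere, its excess k over C G u has zero integral over the ball,
   hence a continuous majorant of capacity at most d/2 *)
have exc n (d : R) : (0 < d)%R -> exists g, [/\ lscplus g, forall x, F n x <= D x + g x &
    cap_G G g <= d%:E].
  move=> d0; have d20 : (0 < d / 2)%R by rewrite divr_gt0.
  have [_ infE] := HF n.
  have [|_ [h [Hh hF] <-] hd] := @ereal_inf_lt R [set cap_upper G (fun x => F n x - h x) |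
      h in [set h | H0 h /\ forall x, h x <= F n x]] (d / 2)%:E.
    by rewrite infE lte_fin.
  have [g1 [l1 Fg1 g1d]] := cap_upper_lt hd.
  have hf x : h x <= f x by exact: le_trans (Ff n x).
  pose k (x : X) : \bar R := maxe (h x - D x) 0.
  have Hk : H0 k.
    have [hb hu hs] := Hh; split.
    - move=> x; rewrite /k le_max lexx orbT gt_max ltry andbT.
      apply: le_lt_trans (_ : h x < +oo); last by case/andP: (hb x).
      by rewrite geeDl// leeNl oppe0.
    - rewrite /upper_semicontinuous (_ : (fun x => - k x) = (fun x => mine (- h x + D x) 0)).
        apply: lsc_min; last exact: lsc_cst.
        apply: lscD => // x; last by apply: (lt_le_trans ltNy0); exact: D0.
        by rewrite -(fineK (H0_fin x Hh)) -EFinN ltNyr.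
      apply/funext => x; rewrite /k oppe_max oppe0 [h x - D x]addeC.
      by rewrite fin_num_oppeD ?H0_fin// oppeK addeC.
    - apply: compact_supportS hs => x; apply: contra_neq => hx.
      by rewrite /k hx add0e; apply/max_idPr; rewrite leeNl oppe0.
  have k0 mu : energy_le1 G mu -> \int[mu]_x k x < (d / 2)%:E.
    move=> m1; apply: (@le_lt_trans _ _ 0); last by rewrite lte_fin.
    rewrite -[leRHS](integral0 mu [set: borel X]); apply: ae_ge0_le_integral => //.
    - by move=> x _; exact: H0_ge0.
    - exact: H0_measurable.
    have [N [mN N0 hN]] := dominate_ae hX lcX Gk D0 lD Hh (fun mu m1 => hD h mu Hh hf m1) m1.
    exists N; split => // x nk; apply: hN => hx; apply: nk => _.
    by rewrite /k ge_max lexx andbT sube_le0.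
  have [phi [cphi kphi phid]] := H0_dini hX lcX Gk Hk k0.
  have [lphi _] := Ccplus_C0plus cphi.
  exists (fun x => g1 x + (phi x)%:E); split; first exact: lscplusD.
    move=> x; have : F n x <= g1 x + h x by rewrite -leeBlDr ?H0_fin//; exact: Fg1.
    move=> /le_trans; apply; rewrite addeCA leeD2l//.
    have [->|Dy] := eqVneq (D x) +oo; first by rewrite addye ?leey.
    rewrite addeC -leeBlDr; last by rewrite ge0_fin_numE ?D0// ltey.
    by apply: le_trans (kphi x); rewrite /k le_max lexx.
  apply: cap_G_le; first exact: lscplusD.
  move=> mu m1; rewrite lscplus_integralD// [d]splitr EFinD; apply: leeD.
    by apply: le_trans (cap_G_ge l1 m1) _; exact: ltW.
  by apply: ltW; exact: phid.
have dn n : (0 < e2 / (2 ^ n.+1)%:R)%R by rewrite divr_gt0// ltr0n expn_gt0.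
pose g n := projT1 (cid (exc n _ (dn n))).
have gP n : [/\ lscplus (g n), forall x, F n x <= D x + g n x &
    cap_G G (g n) <= (e2 / (2 ^ n.+1)%:R)%:E] := projT2 (cid (exc n _ (dn n))).
have g0 n x : 0 <= g n x by have [[+ _] _ _] := gP n; exact.
have lg n : lower_semicontinuous (g n) by have [[]] := gP n.
pose S x := \sum_(n <oo) g n x.
have LS : lscplus S.
  by split; [move=> x; exact: nneseries_ge0|exact: lsc_nneseries].
apply: (@le_trans _ _ (cap_G G (fun x => D x + S x))).
  apply: cap_upper_le; first exact: lscplusD.
  move=> x; have [N KN] := Kcov x; apply: lee_real_ltP => a ax.
  pose n := maxn N (Num.truncn a).+1.
  have Kx : K n x by apply: KN; exact: leq_maxl.
  apply: (@le_trans _ _ (F n x)).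
    rewrite /F mem_set// le_min (ltW ax) lee_fin.
    apply: ltW; apply: (lt_le_trans (truncnS_gt a)); rewrite ler_nat; exact: leq_maxr.
  have [_ FD _] := gP n; apply: (le_trans (FD x)); rewrite leeD2l//.
  apply: (@le_trans _ _ (\sum_(0 <= k < n.+1) g k x)); last exact: nneseries_lim_ge.
  by rewrite big_nat_recr//= leeDr// sume_ge0.
apply: cap_G_le; first exact: lscplusD.
move=> mu m1; rewrite lscplus_integralD// lscplus_integralZ//; last exact: ltW.
have -> : cap_lower G f + e%:E = C%:E + e2%:E.
  by rewrite -[in LHS](fineK cf) -!EFinD /C /e2 -addrA -splitr.
apply: leeD.
  rewrite -[leRHS]mule1; apply: lee_wpmul2l; first by rewrite lee_fin ltW.
  exact: (mutual_energy_le1 Gp u1 m1).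
rewrite /S integral_nneseries//; last by move=> n; exact: lsc_measurable.
apply: (@le_trans _ _ (\sum_(n <oo) (e2 / (2 ^ n.+1)%:R)%:E)).
  apply: lee_nneseries => [n _ _|n _]; first exact: integral_ge0.
  by have [l _ c] := gP n; exact: le_trans (cap_G_ge l m1) c.
have := @epsilon_trick R (fun=> 0) e2 xpredT (fun=> lexx _) (ltW e20).
by rewrite [X in _ <= X + _ -> _]eseries0// add0e; under eq_eseriesr do rewrite add0e.
Qed.

(** Off a set of small capacity, f is continuous and the indicator of A is u.s.c.
    At a point of A the bound a < - f x is strict and, as a is negative, it
    propagates to nearby points of A and trivially to the others.  Near a point
    off A, the indicator is less than 1, hence 0. *)
Lemma quasi_usc_indic f (A : set X) : Fplus f -> quasicontinuous G f -> quasiclosed G A ->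
  quasi_usc G (fun x => if x \in A then f x else 0).
Proof.
move=> f0 qc qA e e0; have e20 : (0 < e / 2)%R by rewrite divr_gt0.
have [V1 /cap_upper_lt[g1 [l1 Vg1 c1]] cV1] := qc _ e20.
have [V2 /cap_upper_lt[g2 [l2 Vg2 c2]] /usc_subspaceP uV2] := qA _ e20.
exists (V1 `|` V2).
  apply: (@le_lt_trans _ _ (cap_G G (fun x => g1 x + g2 x))).
    apply: cap_upper_le; first exact: lscplusD.
    move=> x; apply: (le_trans _ (leeD (Vg1 x) (Vg2 x))).
    rewrite /indic_ereal -EFinD lee_fin !indicE in_setU -natrD ler_nat.
    by case: (x \in V1); case: (x \in V2).
  apply: (@le_lt_trans _ _ (cap_G G g1 + cap_G G g2)).
    apply: cap_G_le; first exact: lscplusD.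
    move=> mu m1; rewrite lscplus_integralD//.
    by apply: leeD; exact: cap_G_ge.
  by rewrite [e]splitr EFinD; apply: lteD.
apply/usc_subspaceP => x a nV; have nV1 : ~ V1 x by move=> ?; apply: nV; left.
have nV2 : ~ V2 x by move=> ?; apply: nV; right.
case: (boolP (x \in A)) => [/set_mem Ax ax|/negP xA].
  have a0 : (a%:E < 0).
    by apply: (lt_le_trans ax); rewrite leeNl oppe0; exact: f0.
  have /subspace_continuousP/(_ x nV1) := cV1.
  move=> /(_ [set y | y < - a%:E]) H.
  have : nbhs x [set y | (~` V1) y -> (f y < - a%:E)].
    apply: H; apply: open_nbhs_nbhs; split; [exact: open_ereal_lt_ereal|].
    by change (f x < - a%:E); rewrite lteNr.
  apply: filterS => y h nVy; case: (boolP (y \in A)) => _; last by rewrite oppe0.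
  by rewrite lteNr; apply: h => ?; apply: nVy; left.
rewrite oppe0 => a0.
have ind0 : indic_ereal R A x = 0 by rewrite /indic_ereal indicE (negbTE (introN idP xA)).
(* any threshold strictly between -1 and 0 separates the values of - 1_A *)
have : nbhs x [set y | ~ V2 y -> ((- (1 / 2))%R%:E < - indic_ereal R A y)].
  by apply: uV2 => //; rewrite ind0 oppe0 lte_fin oppr_lt0 divr_gt0.
apply: filterS => y h nVy; case: (boolP (y \in A)) => yA; last by rewrite oppe0.
have : ((- (1 / 2))%R%:E < - indic_ereal R A y) by apply: h => ?; apply: nVy; right.
by rewrite /indic_ereal indicE yA -EFinN lte_fin ltrN2 /= ltNge ler_pdivrMr// mul1r ler1n.
Qed.

End capacities.

Local Open Scope ereal_scope.

Theorem lemma4p2 (R : realType) (X : ptopologicalType)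
    (X_hausdorff : hausdorff_space X) (X_lc : locally_compact [set: X])
    (G : X -> X -> \bar R) (G_kernel : potential_kernel G)
    (G_consistent : consistent G) (G_posdef : positive_definite G)
    (omega : radon R X) (qc : quasicontinuous G (potential G omega))
    (A : set X) (qA : quasiclosed G A) :
  let f : X -> \bar R := fun x => if x \in A then potential G omega x else 0 in
  (cap_upper G f < +oo -> H0star G f) /\
  (@second_countable X -> cap_upper G f = cap_lower G f).
Proof.
move=> f; have G0 : Fplus (potential G omega) by move=> x; exact: potential_ge0.
have f0 : Fplus f by move=> x; rewrite /f; case: ifP => _ //; exact: G0.
have qf : quasi_usc G f by exact: quasi_usc_indic.
split; first exact: quasi_usc_H0star.
exact: quasi_usc_capacitable.
Qed.
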